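(* For each $N$, let $\boldsymbol{y}_N = \boldsymbol{m}_N^0 + \boldsymbol{\varepsilon}_N \in \mathbb{R}^N$, where $\boldsymbol{m}_N^0\in\mathbb{R}^N$ is deterministic and $\boldsymbol{\varepsilon}_N$ is a random vector of independent and identically distributed (non-degenerate) normal components. Let $1 = t_0^0 < t_1^0 < \cdots < t_{M^0-1}^0 < t_{M^0}^0 = N+1$, where $t_1^0,\dots,t_{M^0-1}^0$ are the change points of $\boldsymbol{m}_N^0$ (these quantities may depend on $N$), and let $s_k^0 := \mathrm{sgn}\big((\boldsymbol{m}_N^0)_{t_k^0} - (\boldsymbol{m}_N^0)_{t_{k-1}^0}\big)$, $k=1,\dots,M^0-1$. Assume that, for a constant $c>0$ not depending on $N$: (a) $\min_{k=1,\dots,M^0} (t_k^0 - t_{k-1}^0) \geq cN$; (b) there is a pair of consecutive signs, $s_k^0$ and $s_{k+1}^0$, which are equal. Then the FLSA estimate is $\varepsilon$-sign-inconsistent.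
   Context: For data $\boldsymbol{y}=[y_1,\dots,y_N]^T$ and $\lambda>0$, the FLSA (fused lasso signal approximator) estimate is the optimal solution of $$\min_{m_1,\dots,m_N} \frac12\sum_{t=1}^N (y_t-m_t)^2 + \lambda\sum_{t=2}^N |m_t-m_{t-1}|.$$ A change point of a vector $\boldsymbol{m}=[m_1,\dots,m_N]^T$ is an index $t\in\{2,\dots,N\}$ with $m_t\neq m_{t-1}$. Definition ($\varepsilon$-sign-consistency): the FLSA estimate is $\varepsilon$-sign-consistent if, given any $\varepsilon,\gamma>0$, there is an $N_0\in\mathbb{N}$ such that, for all $N\geq N_0$, with probability at least $1-\gamma$ the following holds: there is a $\lambda>0$ (which may depend on the data) such that the optimal solution $\boldsymbol{m}_N$ of the problem $$\min_{m_1,\dots,m_N} \frac12\sum_{t=1}^N \big((\boldsymbol{y}_N)_t-m_t\big)^2 + \lambda\sum_{t=2}^N |m_t-m_{t-1}|$$ with data $\boldsymbol{y}_N$ has all its change points inside an $\varepsilon N$-neighborhood of the change points of $\boldsymbol{m}_N^0$, and for every change point of $\boldsymbol{m}_N^0$ there is a change point of $\boldsymbol{m}_N$ at a distance of at most $\varepsilon N$. Otherwise, the FLSA estimate is $\varepsilon$-sign-inconsistent. *)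

(* Defs.v *)
From HB Require Import structures.
From mathcomp Require Import all_boot all_order all_algebra.
From mathcomp Require Import all_classical all_reals all_analysis.

Set Implicit Arguments.
Unset Strict Implicit.
Unset Printing Implicit Defensive.

Import Order.TTheory GRing.Theory Num.Theory.
Import numFieldNormedType.Exports.

Local Open Scope classical_set_scope.
Local Open Scope ring_scope.

(* Components are numbered from 1: [entry m t] is m_t for 1 <= t <= N. Its
   other values (m_1 at t = 0, and 0 for t > N) are junk. *)
Definition entry (R : realType) (N : nat) (m : 'cV[R]_N) (t : nat) : R :=
  if insub t.-1 is Some i then m i 0 else 0.

Definition change_point (R : realType) (N : nat) (m : 'cV[R]_N) (t : nat) :
    Prop :=
  (2 <= t <= N)%N /\ entry m t <> entry m t.-1.

Definition flsa_objective (R : realType) (N : nat) (y : 'cV[R]_N) (lambda : R)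
    (m : 'cV[R]_N) : R :=
  2%:R^-1 * (\sum_(1 <= t < N.+1) (entry y t - entry m t) ^+ 2)
  + lambda * (\sum_(2 <= t < N.+1) `|entry m t - entry m t.-1|).

Definition is_flsa_estimate (R : realType) (N : nat) (y : 'cV[R]_N)
    (lambda : R) (m : 'cV[R]_N) : Prop :=
  forall m' : 'cV[R]_N, flsa_objective y lambda m <= flsa_objective y lambda m'.

Definition change_points_match (R : realType) (N : nat) (e : R)
    (m0 m : 'cV[R]_N) : Prop :=
  (forall t, change_point m t ->
     exists2 t', change_point m0 t' & `|t%:R - t'%:R : R| <= e * N%:R) /\
  (forall t', change_point m0 t' ->
     exists2 t, change_point m t & `|t%:R - t'%:R : R| <= e * N%:R).

(* "With probability at least 1 - gamma, X holds" means that X holds throughout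
   some measurable event of probability at least 1 - gamma, so that
   measurability of X itself need not be established beforehand. *)
Definition eps_sign_consistent (R : realType) (d : measure_display)
    (T : measurableType d) (P : probability T R)
    (m0 : forall N, 'cV[R]_N) (y : forall N, T -> 'cV[R]_N) : Prop :=
  forall e gamma : R, 0 < e -> 0 < gamma ->
  exists N0 : nat, forall N : nat, (N0 <= N)%N ->
  exists A : set T,
    [/\ measurable A,
        ((1 - gamma)%:E <= P A)%E &
        forall w, A w ->
          exists (lambda : R) (m : 'cV[R]_N),
            [/\ 0 < lambda, is_flsa_estimate (y N w) lambda m &
                change_points_match e (m0 N) m]].

Definition eps_sign_inconsistent (R : realType) (d : measure_display)
    (T : measurableType d) (P : probability T R)
    (m0 : forall N, 'cV[R]_N) (y : forall N, T -> 'cV[R]_N) : Prop :=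
  ~ eps_sign_consistent P m0 y.

Definition independent_RVs (R : realType) (d : measure_display)
    (T : measurableType d) (P : probability T R) (I : finType)
    (X : I -> {RV P >-> R}) : Prop :=
  forall (J : {set I}) (B : I -> set R),
    (forall i, i \in J -> measurable (B i)) ->
    P (\bigcap_(i in [set` J]) (X i @^-1` B i))
      = (\prod_(i in J) P (X i @^-1` B i))%E.

Definition normal_RV (R : realType) (d : measure_display)
    (T : measurableType d) (P : probability T R) (X : {RV P >-> R})
    (mu sigma : R) : Prop :=
  forall B : set R, measurable B -> distribution P X B = normal_prob mu sigma B.

Definition iid_normal (R : realType) (d : measure_display)
    (T : measurableType d) (P : probability T R) (I : finType)
    (X : I -> {RV P >-> R}) (mu sigma : R) : Prop :=
  independent_RVs X /\ forall i, normal_RV (X i) mu sigma.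

(* 1 = t_0 < t_1 < ... < t_M = N + 1, where t_1, ..., t_(M-1) are exactly the
   change points of m. *)
Definition change_point_sequence (R : realType) (N : nat) (m : 'cV[R]_N)
    (M : nat) (t : nat -> nat) : Prop :=
  [/\ t 0%N = 1%N,
      t M = N.+1,
      forall k, (k < M)%N -> (t k < t k.+1)%N &
      forall s, change_point m s <-> exists2 k, (1 <= k < M)%N & s = t k].

Definition jump_sign (R : realType) (N : nat) (m : 'cV[R]_N) (t : nat -> nat)
    (k : nat) : R :=
  Num.sg (entry m (t k) - entry m (t k.-1)).

(* Main.v *)
Require Import Defs.
From HB Require Import structures.
From mathcomp Require Import all_boot all_order all_algebra.
From mathcomp Require Import all_classical all_reals all_analysis.
From mathcomp Require Import measurable_realfun zify ring lra.

Set Implicit Arguments.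
Unset Strict Implicit.
Unset Printing Implicit Defensive.

Import Order.TTheory GRing.Theory Num.Theory.
Import numFieldNormedType.Exports.

Local Open Scope classical_set_scope.
Local Open Scope ring_scope.

(* Let A < B be consecutive true change points with equal signs, say two upward
   jumps, and let V be the partial sums of y - m for the FLSA estimate m. The
   optimality conditions say that |V| <= lambda, with V = -lambda at the upward
   and V = lambda at the downward jumps of m. Suppose that, in units of
   Q = sigma sqrt N, the centred noise walk is nearly constant on small windows
   around A and B, takes nearly the same value at A, at B and at two points at
   distance of order N to the left of A and to the right of B, and between A and
   B climbs to a large height D and then falls to -D. If all jumps of m lie in
   the windows, then lambda is at least of order D. Let a be the last jump of m
   in the window of A, b the first one in the window of B, and x the true level
   minus the level of m on [a, b). If a and b are both upward, the dip to -D
   violates V >= -lambda; if a or b is downward, then V <= lambda at the outer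
   points forces x (up to sign) and the true jump to be O(Q/N), which contradicts
   the peak D or the crossing of the tube |V| <= lambda between a and b. The true
   jumps may have any size, since they only ever help.
   Such a noise path has probability at least a constant independent of N: the
   block increments are independent normal variables, and the windows are
   controlled by Ottaviani's inequality. *)

(* The contexts below mix facts about [nat] and about [R]; [lia] and [lra] are
   only usable once the facts of the other sort have been cleared. *)
Ltac nat_lia :=
  repeat match goal with
  | H : forall _, _ |- _ => clear H
  | H : ex _ |- _ => clear H
  | H : is_true (@Order.le _ _ _ _) |- _ => clear H
  | H : is_true (@Order.lt _ _ _ _) |- _ => clear H
  | H : @eq (GRing.Zmodule.sort _) _ _ |- _ => clear H
  | H : @eq (Num.RealField.sort _) _ _ |- _ => clear H
  end; lia.

Ltac real_lra :=
  repeat match goal with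
  | H : forall _, _ |- _ => clear H
  | H : ex _ |- _ => clear H
  | H : is_true (leq _ _) |- _ => clear H
  | H : is_true (andb _ _) |- _ => clear H
  end; lra.

(** * Independent blocks *)

(** As functions of [A], both sides are finite measures: the restriction of [P] to [E], and [P]
    scaled by [P E]. They agree on the pi-system [G], which contains the whole space, hence on the
    sigma-algebra that it generates. *)
Lemma g_sigma_algebra_indep (R : realType) (d : measure_display)
    (T : measurableType d) (P : probability T R) (G : set (set T)) (E : set T) :
  setI_closed G -> G setT -> G `<=` measurable -> measurable E ->
  (forall A, G A -> P (A `&` E) = (P A * P E)%E) ->
  forall A, <<s G >> A -> P (A `&` E) = (P A * P E)%E.
Proof.
move=> GI GT Gm mE GE A sGA.
have PE0 : 0 <= fine (P E) by rewrite fine_ge0.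
have PEE : P E = (NngNum PE0)%:num%:E by rewrite /= fineK// fin_num_measure.
pose m1 : {measure set T -> \bar R} := mrestr P mE.
pose m2 : {measure set T -> \bar R} := mscale (NngNum PE0) P.
rewrite -[LHS]/(m1 A) muleC PEE -[RHS]/(m2 A).
apply: (g_sigma_algebra_measure_unique G Gm (fun=> setT)) => //.
- by rewrite bigcup_const//; exists 0%N.
- move=> B GB; rewrite -[LHS]/(P (B `&` E)) -[RHS]/((NngNum PE0)%:num%:E * P B)%E.
  by rewrite -PEE muleC GE.
- move=> _; rewrite -[m1 _]/(P (setT `&` E)) setTI.
  by rewrite (le_lt_trans (probability_le1 _ _))// ltry.
Qed.

Section blocks.
Variables (R : realType) (d : measure_display) (T : measurableType d).
Variables (P : probability T R) (I : finType) (X : I -> {RV P >-> R}).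
Implicit Types J K : {set I}.

(** The pi-system of cylinder events, on which [independent_RVs] speaks directly. It generates the
    sigma-algebra of the variables [X i] with [i] in [J]. *)
Definition block_rectangles J : set (set T) :=
  [set \bigcap_(i in [set` J]) (X i @^-1` B i) |
     B in [set B : I -> set R | forall i, measurable (B i)]].

Lemma block_rectanglesI J : setI_closed (block_rectangles J).
Proof.
move=> _ _ [B mB <-] [C mC <-]; exists (fun i => B i `&` C i).
  by move=> i; apply: measurableI; [exact: mB|exact: mC].
by rewrite -bigcapI.
Qed.

Lemma block_rectanglesT J : block_rectangles J setT.
Proof.
exists (fun=> setT) => [i|]; first exact: measurableT.
by apply/seteqP; split => // w _ i _.
Qed.

Lemma measurable_RV (i : I) (B : set R) : measurable B -> measurable (X i @^-1` B).
Proof.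
by move=> mB; rewrite -[X in measurable X]setTI; exact: measurable_funP.
Qed.

Lemma measurable_block_rectangles J : block_rectangles J `<=` measurable.
Proof.
move=> _ [B mB <-]; apply: fin_bigcap_measurable; first exact: finite_finset.
by move=> i _; exact: measurable_RV.
Qed.

Lemma measurable_block J : <<s block_rectangles J >> `<=` @measurable d T.
Proof.
apply: smallest_sub; first exact: sigma_algebra_measurable.
exact: measurable_block_rectangles.
Qed.

Hypothesis indepX : independent_RVs X.

(** The pi-system argument is used twice, first to reduce [A] and then [E] to rectangles. Two
    rectangles over disjoint index sets merge into one over [J :|: K], where the product formula
    applies. *)
Lemma block_indep J K (A E : set T) : {in J, forall i, i \notin K} ->
  <<s block_rectangles J >> A -> <<s block_rectangles K >> E ->
  P (A `&` E) = (P A * P E)%E.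
Proof.
move=> JK sA sE.
move: A sA; apply: g_sigma_algebra_indep.
- exact: block_rectanglesI.
- exact: block_rectanglesT.
- exact: measurable_block_rectangles.
- exact: measurable_block sE.
move=> A rA; rewrite setIC muleC.
move: E sE; apply: g_sigma_algebra_indep.
- exact: block_rectanglesI.
- exact: block_rectanglesT.
- exact: measurable_block_rectangles.
- exact: measurable_block_rectangles rA.
move=> _ [C mC <-]; move: rA => [B mB <-].
pose D i := if i \in J then B i else C i.
have KJ i : i \in K -> (i \in J) = false.
  by move=> iK; apply/negbTE/negP => /JK; rewrite iK.
have -> : \bigcap_(i in [set` J]) (X i @^-1` B i) =
          \bigcap_(i in [set` J]) (X i @^-1` D i).
  by apply: eq_bigcapr => i /= iJ; rewrite /D iJ.
have -> : \bigcap_(i in [set` K]) (X i @^-1` C i) =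
          \bigcap_(i in [set` K]) (X i @^-1` D i).
  by apply: eq_bigcapr => i /= iK; rewrite /D KJ.
have mD i : measurable (D i) by rewrite /D; case: ifP.
rewrite -bigcap_setU.
have -> : [set` K] `|` [set` J] = [set` (K :|: J)].
  by apply/seteqP; split => i /=; rewrite inE; [case=> ->|move/orP]; rewrite ?orbT.
rewrite !indepX// -bigU/=; first by apply: eq_bigl => i; rewrite !inE.
rewrite disjoint_subset; apply/fintype.subsetP => i iK.
by rewrite inE; apply/negP => /JK; rewrite iK.
Qed.

Definition block_sum J (w : T) : R := \sum_(i in J) X i w.

Lemma measurable_block_sum J K : J \subset K ->
  forall B, measurable B -> <<s block_rectangles K >> (block_sum J @^-1` B).
Proof.
move=> JK B mB.
(* The sample space is given the smaller sigma-algebra as its measurable structure, so that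
   measurability of finite sums applies to it. *)
pose T' : measurableType _ := g_sigma_algebraType (block_rectangles K).
have mX i : i \in K -> @measurable_fun _ _ T' R setT (X i).
  move=> iK _ C mC; rewrite setTI; apply: sub_sigma_algebra.
  exists (fun j => if j == i then C else setT).
    by move=> j; case: ifP => // _; exact: measurableT.
  apply/seteqP; split => w /=.
    by move=> /(_ i iK) /=; rewrite eqxx.
  by move=> Cw j _ /=; case: eqP => [->|].
have mS : @measurable_fun _ _ T' R setT (block_sum J).
  rewrite (_ : block_sum J =
    (fun w => \sum_(i <- index_enum I) (if i \in J then X i w else 0))); last first.
    by apply/funext => w; rewrite /block_sum big_mkcond.
  apply: (@measurable_sum _ T' R setT I (index_enum I)
    (fun i w => if i \in J then X i w else 0)) => i /=.
  have [iJ|iJ] := boolP (i \in J); last exact: measurable_cst.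
  by apply: mX; exact: (fintype.subsetP JK).
by have := mS measurableT B mB; rewrite setTI.
Qed.
End blocks.

(** * Normal laws *)

(** Lebesgue measure pushed forward by a translation has the same value on half-open intervals, so
    it is Lebesgue measure again. *)
Lemma integral_lebesgue_shift (R : realType) (c : R) (A : set R)
    (f : R -> \bar R) : measurable A -> measurable_fun A f ->
  (forall x, 0 <= f x)%E ->
  (\int[lebesgue_measure]_(x in A) f x =
   \int[lebesgue_measure]_(x in +%R c @^-1` A) f (c + x)%R)%E.
Proof.
move=> mA mf f0.
have mc : measurable_fun setT (+%R c : measurableTypeR R -> measurableTypeR R).
  exact: measurable_funD.
pose phi : {mfun measurableTypeR R >-> measurableTypeR R} :=
  HB.pack (+%R c : measurableTypeR R -> measurableTypeR R)
    (isMeasurableFun.Build _ _ _ _ _ mc).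
transitivity (\int[pushforward (@lebesgue_measure R) phi]_(x in A) f x)%E.
  apply: eq_measure_integral => B mB BA.
  apply: lebesgue_measure_unique => // _ [[a b]] _ <-.
  rewrite /= /pushforward.
  have -> : +%R c @^-1` [set` `]a, b]] = [set` `](a - c), (b - c)]].
    by apply/seteqP; split => x /=; rewrite !in_itv/= ltrBlDl lerBrDl.
  rewrite !lebesgue_measure_itv/= !lte_fin ltrD2r.
  by case: ifP => // _; rewrite -!EFinB; congr EFin; ring.
exact: ge0_integral_pushforward.
Qed.

Lemma normal_pdf_shift (R : realType) (c m s x : R) : s != 0 ->
  normal_pdf (c + m) s (c + x) = normal_pdf m s x.
Proof.
move=> s0; rewrite !normal_pdfE// /normal_fun.
by rewrite opprD addrACA subrr add0r.
Qed.

Lemma normal_prob_shift (R : realType) (c m s : R) (A : set R) : s != 0 ->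
  measurable A -> normal_prob m s (+%R c @^-1` A) = normal_prob (c + m) s A.
Proof.
move=> s0 mA; rewrite /normal_prob [RHS](integral_lebesgue_shift c mA).
- by apply: eq_integral => x _; rewrite normal_pdf_shift.
- apply/measurable_EFinP; apply: measurable_funTS; exact: measurable_normal_pdf.
- by move=> x; rewrite lee_fin normal_pdf_ge0.
Qed.

Lemma normal_peakE (R : realType) (s : R) : 0 < s ->
  normal_peak s = (s * Num.sqrt (pi *+ 2))^-1.
Proof.
move=> s0; rewrite /normal_peak -mulrnAr sqrtrM ?sqr_ge0// sqrtr_sqr.
by rewrite gtr0_norm.
Qed.

(** Completing the square in [x]: the joint density of a first summand [x] and the sum [z] is the
    density of the sum times the conditional density of [x] given [z]. *)
Lemma normal_pdfM (R : realType) (m1 m2 s1 s2 x z : R) : 0 < s1 -> 0 < s2 ->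
  let s := Num.sqrt (s1 ^+ 2 + s2 ^+ 2) in
  normal_pdf m1 s1 x * normal_pdf (x + m2) s2 z =
  normal_pdf (m1 + m2) s z *
  normal_pdf ((m1 * s2 ^+ 2 + (z - m2) * s1 ^+ 2) / s ^+ 2) (s1 * s2 / s) x.
Proof.
move=> s1_gt0 s2_gt0 s.
have ss : s ^+ 2 = s1 ^+ 2 + s2 ^+ 2.
  by rewrite sqr_sqrtr// addr_ge0// sqr_ge0.
have s_gt0 : 0 < s by rewrite sqrtr_gt0 addr_gt0// exprn_gt0.
have s'_gt0 : 0 < s1 * s2 / s by rewrite divr_gt0// mulr_gt0.
have pi2 : 0 < Num.sqrt ((pi : R) *+ 2) by rewrite sqrtr_gt0 mulrn_wgt0// pi_gt0.
rewrite !normal_pdfE ?gt_eqF//= !normal_peakE//.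
rewrite mulrACA [RHS]mulrACA; congr (_ * _).
  by field; rewrite !gt_eqF.
rewrite /normal_fun -!expRD; congr expR.
rewrite !exprMn !exprVn ss; field.
by rewrite !gt_eqF//= addr_gt0// exprn_gt0.
Qed.

(** The Radon-Nikodym derivative of the normal law is almost everywhere its density, since both have
    the same integrals over measurable sets. The bound on [f] provides integrability. *)
Lemma integral_normal_prob (R : realType) (m s : R) (f : R -> \bar R) : s != 0 ->
  measurable_fun setT f -> (forall x, (0 <= f x <= 1)%E) ->
  (\int[normal_prob m s]_x f x =
   \int[lebesgue_measure]_x (f x * (normal_pdf m s x)%:E))%E.
Proof.
move=> s0 mf f01.
have dom := normal_prob_dominates m s.
have If : (normal_prob m s).-integrable setT f.
  apply/integrableP; split => //.
  apply: (@le_lt_trans _ _ (\int[normal_prob m s]_x cst 1%E x)%E).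
    apply: ge0_le_integral => //; first exact: measurableT_comp.
    by move=> x _; have /andP[f0 f1] := f01 x; rewrite gee0_abs.
  by rewrite integral_cst//= mul1e probability_setT ltry.
rewrite -(Radon_Nikodym_change_of_variables dom)//=.
apply: ae_eq_integral => //.
- exact: emeasurable_funM.
- apply: emeasurable_funM => //; apply/measurable_EFinP.
  exact: measurable_normal_pdf.
apply: ae_eqe_mul2l => /=; apply: integral_ae_eq => //.
- exact: Radon_Nikodym_integrable.
- apply/measurable_EFinP; exact: measurable_normal_pdf.
- by move=> E _ mE; rewrite -Radon_Nikodym_integral.
Qed.

Lemma normal_prob_conv (R : realType) (d : measure_display) (T : measurableType d)
    (P : probability T R) (X Y : T -> R) (m1 s1 m2 s2 : R) :
  0 < s1 -> 0 < s2 ->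
  measurable_fun setT X -> measurable_fun setT Y ->
  (forall A B, measurable A -> measurable B ->
     P (X @^-1` A `&` Y @^-1` B) = (P (X @^-1` A) * P (Y @^-1` B))%E) ->
  (forall A, measurable A -> P (X @^-1` A) = normal_prob m1 s1 A) ->
  (forall A, measurable A -> P (Y @^-1` A) = normal_prob m2 s2 A) ->
  forall A, measurable A -> P ((X \+ Y) @^-1` A) =
    normal_prob (m1 + m2) (Num.sqrt (s1 ^+ 2 + s2 ^+ 2)) A.
Proof.
move=> s10 s20 mX mY XY lX lY B mB.
have s1n0 : s1 != 0 by rewrite gt_eqF.
have s2n0 : s2 != 0 by rewrite gt_eqF.
have mX' : measurable_fun setT (X : T -> measurableTypeR R) by exact: mX.
have mY' : measurable_fun setT (Y : T -> measurableTypeR R) by exact: mY.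
pose phi w := (X w : measurableTypeR R, Y w : measurableTypeR R).
have mphi : measurable_fun setT phi by exact/measurable_fun_pair.
pose Z : set (measurableTypeR R * measurableTypeR R) := [set z | B (z.1 + z.2)].
have mZ : measurable Z.
  rewrite -[Z]setTI.
  have : measurable_fun setT (fun z : measurableTypeR R * measurableTypeR R => z.1 + z.2).
    by apply: measurable_funD; [exact: measurable_fst|exact: measurable_snd].
  by apply.
have -> : P ((X \+ Y) @^-1` B) = pushforward P phi Z by [].
(* By independence the joint law agrees with the product measure on rectangles, hence everywhere. *)
have <- : (normal_prob m1 s1 \x normal_prob m2 s2)%E Z = pushforward P phi Z.
  pose m' : {measure set _ -> \bar R} := pushforward P phi.
  apply: (@product_measure_unique _ _ _ _ R (normal_prob m1 s1)
    (normal_prob m2 s2) (m' mphi)) => // A C mA mC /=.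
  by rewrite /pushforward -lX// -lY// -XY.
rewrite /product_measure1/=.
have inner x : normal_prob m2 s2 (xsection Z x) = normal_prob (x + m2) s2 B.
  rewrite -normal_prob_shift//; congr (normal_prob _ _ _).
  by apply/seteqP; split => y; rewrite /xsection/= inE.
have minner : measurable_fun setT
    (fun x : measurableTypeR R => normal_prob ((x : R) + m2) s2 B).
  rewrite (_ : (fun x => _) = normal_prob m2 s2 \o xsection Z).
    exact: measurable_fun_xsection.
  by apply/funext => x; rewrite -inner.
under eq_integral do rewrite inner.
pose g x z := ((normal_pdf m1 s1 x * normal_pdf (x + m2) s2 z) * \1_B z)%:E.
have mg : measurable_fun setT
    (fun u : measurableTypeR R * measurableTypeR R => g u.1 u.2).
  apply/measurable_EFinP; apply: measurable_funM; last first.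
    by apply: measurableT_comp => //; exact: measurable_snd.
  apply: measurable_funM.
    by apply: measurableT_comp; [exact: measurable_normal_pdf|exact: measurable_fst].
  rewrite (_ : (fun u => _) = (fun u : measurableTypeR R * measurableTypeR R =>
      normal_pdf m2 s2 (u.2 - u.1))).
    apply: measurableT_comp; first exact: measurable_normal_pdf.
    by apply: measurable_funB; [exact: measurable_snd|exact: measurable_fst].
  by apply/funext => u; rewrite -[RHS](normal_pdf_shift u.1)// [_ + (_ - _)]addrC subrK.
have g0 x z : (0 <= g x z)%E.
  by rewrite lee_fin !mulr_ge0// ?normal_pdf_ge0.
transitivity (\int[lebesgue_measure]_x \int[lebesgue_measure]_z (g x z))%E.
  rewrite integral_normal_prob//.
  - apply: eq_integral => x _.
    rewrite muleC /normal_prob integral_mkcond/= -ge0_integralZl//=.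
    + apply: eq_integral => z _; rewrite /g patchE indicE.
      by case: ifPn => zB; rewrite ?mulr1 ?mulr0 ?mule0 ?EFinM.
    + apply/(measurable_restrictT _ mB)/measurable_EFinP/measurable_funTS.
      exact: measurable_normal_pdf.
    + move=> z _; rewrite patchE; case: ifP => // _.
      by rewrite lee_fin normal_pdf_ge0.
    + by rewrite lee_fin normal_pdf_ge0.
  - move=> x; rewrite measure_ge0 probability_le1//.
have := @fubini_tonelli _ _ _ _ R lebesgue_measure lebesgue_measure _ mg
  (fun u => g0 u.1 u.2).
rewrite /fubini_F /fubini_G /= => ->.

rewrite /normal_prob [RHS]integral_mkcond.
apply: eq_integral => z _.
set s := Num.sqrt (s1 ^+ 2 + s2 ^+ 2).
(* This is the conditional mean of the first summand given the sum [z]. The conditional density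
   integrates to 1, which leaves the density of the sum. *)
pose m' := (m1 * s2 ^+ 2 + (z - m2) * s1 ^+ 2) / s ^+ 2.
transitivity ((\1_B z * normal_pdf (m1 + m2) s z)%:E * 1)%E; last first.
  by rewrite mule1 patchE indicE; case: ifPn => zB; rewrite ?mul1r ?mul0r.
rewrite -(integral_normal_pdf m' (s1 * s2 / s)).
rewrite -ge0_integralZl//.
- apply: eq_integral => x _; rewrite /g -EFinM normal_pdfM//; congr EFin; ring.
- by apply/measurable_EFinP; exact: measurable_normal_pdf.
- by move=> x _; rewrite lee_fin normal_pdf_ge0.
- by rewrite lee_fin mulr_ge0 ?normal_pdf_ge0.
Qed.

(** Compare with the normal law of doubled standard deviation: at distance at least [a] from the
    mean the ratio of the densities is at most [2 * expR (- (3 * a ^+ 2 / (8 * s ^+ 2)))], where 3/8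
    = 1/2 - 1/8. *)
Lemma normal_prob_tail (R : realType) (m s a : R) : 0 < s -> 0 <= a ->
  (normal_prob m s [set x : R | (a <= `|x - m|)%R] <=
   (2 * expR (- (3 * a ^+ 2 / (8 * s ^+ 2))))%:E)%E.
Proof.
move=> s0 a0.
set A := [set x | _]; set k := 2 * expR _.
have k0 : 0 <= k by rewrite mulr_ge0// expR_ge0.
have mA : measurable A.
  have mf : measurable_fun setT (fun x : R => `|x - m|).
    by apply: measurableT_comp => //; exact: measurable_funB.
  rewrite (_ : A = (fun x => `|x - m|) @^-1` [set` `[a, +oo[]).
    by rewrite -[X in measurable X]setTI; exact: mf.
  by apply/seteqP; split => x; rewrite /A/= in_itv/= andbT.
have s2 : 0 < 2 * s by rewrite mulr_gt0.
have pi2 : 0 < Num.sqrt ((pi : R) *+ 2) by rewrite sqrtr_gt0 mulrn_wgt0// pi_gt0.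
have mpdf s' : measurable_fun A (fun x : R => (normal_pdf m s' x)%:E).
  by apply/measurable_EFinP; apply: measurable_funTS; exact: measurable_normal_pdf.
have pdf0 s' x : (0 <= (normal_pdf m s' x)%:E)%E by rewrite lee_fin normal_pdf_ge0.
apply: (@le_trans _ _ (k%:E * normal_prob m (2 * s) A)%E); last first.
  by rewrite -[leRHS]mule1; apply: lee_wpmul2l => //; exact: probability_le1.
rewrite /normal_prob -ge0_integralZl//.
apply: ge0_le_integral => //.
- exact: mpdf.
- by apply: measurable_funeM; exact: mpdf.
- move=> x Ax; rewrite -EFinM lee_fin !normal_pdfE ?gt_eqF//.
  rewrite !normal_peakE//.
  have -> : k * ((2 * s * Num.sqrt (pi *+ 2))^-1 * normal_fun m (2 * s) x) =
      (s * Num.sqrt (pi *+ 2))^-1 * (k / 2 * normal_fun m (2 * s) x).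
    by field; rewrite !gt_eqF.
  rewrite ler_pM2l ?invr_gt0 ?mulr_gt0//.
  rewrite /k [2 * _]mulrC mulfK// mulrC /normal_fun -expRD ler_expR.
  have xa : a ^+ 2 <= (x - m) ^+ 2.
    by rewrite -[leRHS]real_normK ?num_real// lerXn2r// nnegrE.
  rewrite -subr_ge0.
  rewrite (_ : _ - _ = (3 / 8) * ((x - m) ^+ 2 - a ^+ 2) / s ^+ 2).
    by rewrite divr_ge0 ?sqr_ge0// mulr_ge0 ?subr_ge0.
  by field; rewrite gt_eqF.
- exact: mpdf.
Qed.

(** On the whole interval the density is at least its value at distance [k] from the mean. *)
Lemma normal_prob_itv_ge (R : realType) (m s a b k : R) : 0 < s -> a <= b ->
  (forall x, a <= x <= b -> `|x - m| <= k) ->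
  (((b - a) * (normal_peak s * expR (- (k ^+ 2 / (2 * s ^+ 2)))))%:E <=
   normal_prob m s `[a, b])%E.
Proof.
move=> s0 ab hk.
set c := normal_peak s * _.
have c0 : 0 <= c by rewrite mulr_ge0 ?normal_peak_ge0 ?expR_ge0.
apply: (@le_trans _ _ (\int[lebesgue_measure]_(x in `[a, b]) (cst c%:E x))%E).
  rewrite integral_cst//= lebesgue_measure_itv/= lte_fin.
  case: ltP => ab'; first by rewrite -EFinM mulrC.
  by rewrite mule0 lee_fin mulr_le0_ge0// subr_le0.
apply: ge0_le_integral => //.
- by apply/measurable_EFinP; apply: measurable_funTS; exact: measurable_normal_pdf.
- move=> x; rewrite /= in_itv/= => /hk xk.
  rewrite lee_fin normal_pdfE ?gt_eqF// ler_wpM2l ?normal_peak_ge0//.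
  rewrite /normal_fun ler_expR mulNr lerN2 mulr_natl ler_pM2r; last first.
    by rewrite invr_gt0 mulrn_wgt0// exprn_gt0.
  by rewrite -[leLHS]real_normK ?num_real// lerXn2r// nnegrE// (le_trans _ xk).
Qed.

(** * Partial sums of independent normal variables *)

Section normal_blocks.
Variables (R : realType) (d : measure_display) (T : measurableType d).
Variables (P : probability T R) (I : finType) (X : I -> {RV P >-> R}).
Variables (m s : R).
Hypothesis s_gt0 : 0 < s.
Hypothesis iidX : iid_normal X m s.
Implicit Types J K : {set I}.

Local Notation indepX := (proj1 iidX).

Lemma measurable_block_sumT J (B : set R) : measurable B ->
  measurable (block_sum X J @^-1` B).
Proof.
by move=> mB; apply: measurable_block; exact: measurable_block_sum mB.
Qed.

Lemma block_sum_normal J : (0 < #|J|)%N -> forall B, measurable B ->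
  P (block_sum X J @^-1` B) =
  normal_prob (#|J|%:R * m) (s * Num.sqrt #|J|%:R) B.
Proof.
have [n] := ubnP #|J|; elim: n J => // n IH J Jn J0 B mB.
have [j jJ] := card_gt0P J0.
have cJ : #|J| = #|J :\ j|.+1 by rewrite (cardsD1 j) jJ.
have sumJ w : block_sum X J w = X j w + block_sum X (J :\ j) w.
  rewrite /block_sum (bigD1 j)//=; congr (_ + _).
  by apply: eq_bigl => i; rewrite !inE andbC.
(* Singletons are the base case: an empty remainder would have variance zero, which
   [normal_prob_conv] excludes. *)
have [J'0|J'0] := posnP #|J :\ j|.
  rewrite cJ J'0 mul1r sqrtr1 mulr1 -(proj2 iidX j)//.
  congr (P _); apply/funext => w /=; rewrite sumJ /block_sum.
  by rewrite (cards0_eq J'0) big_set0 addr0.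
have lawJ := IH (J :\ j) _ J'0.
have sq0 : 0 < Num.sqrt (#|J :\ j|%:R : R) by rewrite sqrtr_gt0 ltr0n.
transitivity (P ((X j \+ block_sum X (J :\ j)) @^-1` B)).
  by congr (P _); apply/funext => w /=; rewrite sumJ.
have mE : #|J|%:R * m = m + #|J :\ j|%:R * m.
  by rewrite cJ -(add1n #|_|) natrD mulrDl mul1r.
have sE : s * Num.sqrt #|J|%:R =
    Num.sqrt (s ^+ 2 + (s * Num.sqrt #|J :\ j|%:R) ^+ 2).
  rewrite cJ exprMn sqr_sqrtr// -{1}[s ^+ 2]mulr1 -mulrDr nat1r.
  by rewrite sqrtrM ?sqr_ge0// sqrtr_sqr gtr0_norm.
rewrite mE sE; apply: normal_prob_conv mB => //.
- by rewrite mulr_gt0.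
- by move=> _ C mC; rewrite setTI; exact: measurable_block_sumT.
- move=> C D mC mD.
  have -> : X j @^-1` C = block_sum X [set j] @^-1` C.
    by apply/funext => w; rewrite /= /block_sum big_set1.
  apply: (block_indep indepX (J := [set j]) (K := J :\ j)).
  + by move=> i; rewrite !inE => /eqP ->; rewrite eqxx.
  + exact: measurable_block_sum mC.
  + exact: measurable_block_sum mD.
- by move=> C mC; exact: (proj2 iidX j).
- move=> C mC; rewrite lawJ//.
  by rewrite -ltnS -cJ.
Qed.

(** A bound in terms of [n] instead of [#|J|] is uniform over blocks of different lengths, as the
    maximal inequality requires. *)
Lemma block_sum_tail J (n : nat) (a : R) : (#|J| <= n)%N -> 0 < a ->
  (P [set w | (a <= `|block_sum X J w - #|J|%:R * m|)%R] <=
   (2 * expR (- (3 * a ^+ 2 / (8 * (n%:R * s ^+ 2)))))%:E)%E.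
Proof.
move=> Jn a0.
have [J0|J0] := posnP #|J|.
  rewrite (_ : [set w | _] = set0).
    by rewrite measure0 lee_fin mulr_ge0// expR_ge0.
  apply/seteqP; split => // w /=.
  by rewrite J0 mul0r subr0 (cards0_eq J0) /block_sum big_set0 normr0 leNgt a0.
have cJ0 : 0 < #|J|%:R :> R by rewrite ltr0n.
have sqJ : 0 < Num.sqrt (#|J|%:R : R) by rewrite sqrtr_gt0.
have sJ : 0 < s * Num.sqrt #|J|%:R by rewrite mulr_gt0.
have := normal_prob_tail (#|J|%:R * m) sJ (ltW a0).
rewrite -block_sum_normal//; last first.
  have mf : measurable_fun setT (fun x : R => `|x - #|J|%:R * m|).
    by apply: measurableT_comp => //; exact: measurable_funB.
  rewrite (_ : [set x | _] = (fun x => `|x - #|J|%:R * m|) @^-1` [set` `[a, +oo[]).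
    by rewrite -[X in measurable X]setTI; exact: mf.
  by apply/seteqP; split => x /=; rewrite in_itv/= andbT.
move=> /le_trans; apply.
rewrite lee_fin ler_pM2l// ler_expR lerN2 ler_pM2l; last first.
  by rewrite mulr_gt0// exprn_gt0.
have n0 : 0 < n%:R :> R by rewrite ltr0n (leq_trans J0).
rewrite lef_pV2 ?posrE ?mulr_gt0 ?exprn_gt0//.
rewrite ler_pM2l// exprMn mulrC sqr_sqrtr//.
by rewrite ler_pM2r ?exprn_gt0// ler_nat.
Qed.

(** The upper bound [Q] on the standard deviation controls the peak of the density and the lower
    bound [q] its decay, so the estimate is uniform in the length of the block. *)
Lemma block_sum_itv_ge J (q Q k a b : R) : 0 < q -> 0 < Q -> a <= b ->
  q <= s * Num.sqrt #|J|%:R <= Q ->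
  (forall x, a <= x <= b -> `|x| <= k) ->
  (((b - a) * (normal_peak Q * expR (- (k ^+ 2 / (2 * q ^+ 2)))))%:E <=
   P [set w | (a <= block_sum X J w - #|J|%:R * m <= b)%R])%E.
Proof.
move=> q0 Q0 ab /andP[qs sQ] hk.
have s'0 := lt_le_trans q0 qs.
have J0 : (0 < #|J|)%N.
  by rewrite lt0n; apply/eqP => J0; move: s'0; rewrite J0 sqrtr0 mulr0 ltxx.
have h : forall x, #|J|%:R * m + a <= x <= #|J|%:R * m + b -> `|x - #|J|%:R * m| <= k.
  move=> x /andP[h1 h2]; apply: hk.
  by rewrite lerBrDl h1 lerBlDl h2.
have := normal_prob_itv_ge s'0 _ h.
rewrite lerD2l => /(_ ab); rewrite -block_sum_normal//.
rewrite (_ : block_sum X J @^-1` _ =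
  [set w | a <= block_sum X J w - #|J|%:R * m <= b]); last first.
  by apply/seteqP; split => w; rewrite /= in_itv/= lerBrDl lerBlDl.
apply: le_trans; rewrite lee_fin.
rewrite (_ : _ + b - _ = b - a); last by ring.
have sp : 0 < Num.sqrt ((pi : R) *+ 2) by rewrite sqrtr_gt0 mulrn_wgt0// pi_gt0.
have sqJ : 0 < Num.sqrt (#|J|%:R : R) by rewrite sqrtr_gt0 ltr0n.
apply: ler_wpM2l; first by rewrite subr_ge0.
apply: ler_pM; rewrite ?normal_peak_ge0 ?expR_ge0//.
  by rewrite !normal_peakE// lef_pV2 ?posrE ?mulr_gt0// ler_pM2r.
rewrite ler_expR lerN2 ler_wpM2l ?sqr_ge0//.
rewrite lef_pV2 ?posrE ?mulr_gt0 ?exprn_gt0// ler_pM2l//.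
by rewrite lerXn2r// nnegrE ltW.
Qed.
End normal_blocks.

(** * The centred noise walk and its maximal inequality *)

Definition ord_itv (N a b : nat) : {set 'I_N} :=
  finset.finset (fun i : 'I_N => (a <= i < b)%N).

Lemma card_ord_itv (N a b : nat) : (b <= N)%N -> #|ord_itv N a b| = (b - a)%N.
Proof.
move=> bN; rewrite -sum1_card -[RHS]muln1 -sum_nat_const_nat.
rewrite (big_nat_widen a b N)// big_geq_mkord.
by apply: eq_bigl => i; rewrite inE andbC.
Qed.

Section walk.
Variables (R : realType) (d : measure_display) (T : measurableType d).
Variables (P : probability T R) (N : nat) (X : 'I_N -> {RV P >-> R}).
Variables (m s : R).

(** Indices count from 0, so the summands are the noise terms of the times [a + 1] to [b]. The
    subtracted mean is the right one for [b <= N]. *)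
Definition walk (a b : nat) (w : T) : R :=
  block_sum X (ord_itv N a b) w - (b - a)%:R * m.

Lemma walkD (a b c : nat) (w : T) : (a <= b <= c)%N ->
  walk a c w = walk a b w + walk b c w.
Proof.
move=> /andP[ab bc]; rewrite /walk /block_sum.
rewrite (bigID (fun i : 'I_N => (i < b)%N))/=.
have -> : (c - a)%:R = (b - a)%:R + (c - b)%:R :> R.
  by rewrite -natrD addnC addnBA// subnK.
rewrite mulrDl opprD addrACA; congr (_ - _ + (_ - _)); apply: eq_bigl => i; rewrite !inE.
  by rewrite -andbA; case: (ltnP i b) => ib; rewrite ?andbF// (leq_trans ib bc).
rewrite -leqNgt; case: (leqP b i) => ib; rewrite ?andbF//.
by rewrite (leq_trans ab ib) andbT.
Qed.

Lemma measurable_walk (a b a' b' : nat) (B : set R) :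
  (a' <= a)%N -> (b <= b')%N -> measurable B ->
  <<s block_rectangles X (ord_itv N a' b') >> (walk a b @^-1` B).
Proof.
move=> aa bb mB.
have mf : measurable_fun setT (fun x : R => x - (b - a)%:R * m).
  exact: measurable_funB.
have mB' := mf measurableT B mB; rewrite setTI in mB'.
have sub : ord_itv N a b \subset ord_itv N a' b'.
  apply/fintype.subsetP => i; rewrite !inE => /andP[ai ib].
  by rewrite (leq_trans aa ai) (leq_trans ib bb).
exact: measurable_block_sum sub _ mB'.
Qed.

Lemma measurable_walkT (a b : nat) (B : set R) :
  measurable B -> measurable (walk a b @^-1` B).
Proof.
move=> mB; apply: (@measurable_block _ _ _ _ _ X (ord_itv N a b)).
exact: measurable_walk.
Qed.

Hypothesis s_gt0 : 0 < s.
Hypothesis iidX : iid_normal X m s.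

Lemma walk_tail (a b n : nat) (al : R) : (b <= N)%N -> (b - a <= n)%N -> 0 < al ->
  (P [set w | (al <= `|walk a b w|)%R] <=
   (2 * expR (- (3 * al ^+ 2 / (8 * (n%:R * s ^+ 2)))))%:E)%E.
Proof.
move=> bN ban al0.
have := @block_sum_tail _ _ _ _ _ _ _ _ s_gt0 iidX (ord_itv N a b) n al.
by rewrite card_ord_itv//; apply.
Qed.

(* Ottaviani's inequality: at the first time the walk exceeds [2 al] the
   remaining increment is, independently, below [al] with probability at least
   1/2. *)
Lemma walk_max (a n n' : nat) (al eta : R) : (a + n <= N)%N -> (n <= n')%N ->
  0 < al -> eta <= 2^-1 ->
  2 * expR (- (3 * al ^+ 2 / (8 * (n'%:R * s ^+ 2)))) <= eta ->
  exists E : set T, [/\ measurable E, (P E <= (2 * eta)%:E)%E &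
    forall w, ~ E w -> forall k, (k <= n)%N -> `|walk a (a + k) w| < 2 * al].
Proof.
move=> anN nn' al0 eta2 Heta.
pose big : set R := [set x | 2 * al <= `|x|].
have mabs (c : R) : measurable [set x : R | c <= `|x|].
  have mf : measurable_fun setT (fun x : R => `|x|) by exact: measurableT_comp.
  rewrite (_ : [set x | _] = (fun x => `|x|) @^-1` [set` `[c, +oo[]).
    by rewrite -[X in measurable X]setTI; exact: mf.
  by apply/seteqP; split => x /=; rewrite in_itv/= andbT.
(* [A k] says that the walk first reaches height [2 * al] after [k] steps, and [C k] that the
   remaining increment stays below [al]. *)
pose A k := walk a (a + k) @^-1` big `&`
  \bigcap_(j in `I_k) ~` (walk a (a + j) @^-1` big).
pose C k := walk (a + k) (a + n) @^-1` ~` [set x | al <= `|x|].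
have sA k : <<s block_rectangles X (ord_itv N a (a + k)) >> (A k).
  pose T' : measurableType _ :=
    g_sigma_algebraType (block_rectangles X (ord_itv N a (a + k))).
  apply: (@measurableI _ T').
    by apply: measurable_walk => //; exact: mabs.
  apply: (@bigcap_measurableType _ T') => j /= jk.
  apply: (@measurableC _ T'); apply: measurable_walk => //.
    by rewrite leq_add2l ltnW.
  exact: mabs.
have sC k : <<s block_rectangles X (ord_itv N (a + k) (a + n)) >> (C k).
  by apply: measurable_walk => //; apply: measurableC; exact: mabs.
have mA k : measurable (A k) by exact: (measurable_block (sA k)).
have mC k : measurable (C k) by exact: (measurable_block (sC k)).
have indep k : P (A k `&` C k) = (P (A k) * P (C k))%E.
  apply: (block_indep (proj1 iidX)) (sA k) (sC k) => i.
  by rewrite !inE => /andP[_ ik]; rewrite leqNgt ik.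
have PC k : ((2^-1)%:E <= P (C k))%E.
  pose D := [set w | al <= `|walk (a + k) (a + n) w|].
  have mD : measurable D by exact: (measurable_walkT (a + k) (a + n) (mabs al)).
  have -> : C k = ~` D by [].
  rewrite probability_setC// leeBrDr ?fin_num_measure//.
  have := @walk_tail (a + k)%N (a + n)%N n' al anN.
  rewrite subnDl (leq_trans (leq_subr _ _) nn') => /(_ isT al0) h.
  have h2 : (P D <= (2^-1)%:E)%E.
    by rewrite (le_trans h)// lee_fin (le_trans Heta).
  rewrite (le_trans (leeD2l _ h2))// -EFinD lee_fin.
  lra.
have disj : trivIset setT A.
  apply/trivIsetP => i j _ _; wlog ij : i j / (i < j)%N.
    move=> h; rewrite neq_ltn => /orP[ij|ij]; first by apply: h; rewrite ?ltn_eqF.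
    by rewrite setIC; apply: h; rewrite ?ltn_eqF.
  by move=> _; rewrite -subset0 => w [[h _] [_ /(_ i ij)]].
exists (\big[setU/set0]_(k < n.+1) A k); split.
- by apply: bigsetU_measurable => k _; exact: mA.
- rewrite measure_bigsetU//.
  (* By independence and [PC], each [A k] is at most twice as likely as [A k] together with
     [C k]. *)
  apply: (@le_trans _ _ (\sum_(k < n.+1) (2%:E * P (A k `&` C k)))%E).
    apply: lee_sum => k _; rewrite indep muleCA.
    rewrite -[leLHS]mule1; apply: lee_wpmul2l => //.
    rewrite -(@lee_pmul2l _ (2^-1)%:E)// mule1 muleA -EFinM mulVf// mul1e.
    exact: PC.
  rewrite -ge0_sume_distrr//.
  have mAC k : measurable (A k `&` C k) by exact: measurableI.
  have tAC : trivIset setT (fun k => A k `&` C k).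
    apply/trivIsetP => i j _ _ ij; rewrite setIACA.
    by move/trivIsetP : disj => ->//; rewrite set0I.
  rewrite -(@measure_bigsetU _ _ _ P (fun k => A k `&` C k) mAC tAC).
  rewrite EFinM lee_pmul2l//.
  (* On [A k] and [C k] together the complete walk still ends at height at least [al]. *)
  apply: (@le_trans _ _ (P [set w | (al <= `|walk a (a + n) w|)%R])).
    apply: le_measure; rewrite ?inE.
    + by apply: bigsetU_measurable => k _; exact: measurableI.
    + exact: (measurable_walkT a (a + n) (mabs al)).
    + rewrite -(bigcup_mkord n.+1 (fun k => A k `&` C k)) => w [k /= kn [[Ak _] Ck]].
      move: Ak Ck; rewrite /C /big /= => Ak /negP; rewrite -ltNge => Ck.
      rewrite (@walkD a (a + k)%N); last by rewrite leq_addr leq_add2l -ltnS.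
      have := lerB_dist (walk a (a + k) w) (- walk (a + k) (a + n) w).
      rewrite opprK normrN; lra.
  apply: le_trans (walk_tail (n := n') anN _ al0) _; last by rewrite lee_fin.
  by rewrite addKn.
- move=> w nE k kn; rewrite ltNge; apply/negP => wk; apply: nE.
  have ex : exists k, (k <= n)%N && (2 * al <= `|walk a (a + k) w|).
    by exists k; rewrite kn.
  case: (ex_minnP ex) => j /andP[jn wj] jmin.
  rewrite -(bigcup_mkord n.+1 A); exists j; first by rewrite /= ltnS.
  split => //= i /= ij wi.
  have := jmin i; rewrite wi andbT (leq_trans (ltnW ij) jn) => /(_ isT).
  by rewrite leqNgt ij.
Qed.
End walk.

(** * The oscillating noise path and its probability *)

Section oscillation.
Variables (R : realType) (d : measure_display) (T : measurableType d).
Variables (P : probability T R) (N : nat) (X : 'I_N -> {RV P >-> R}).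
Variables (m s : R).
Hypothesis s_gt0 : 0 < s.
Hypothesis iidX : iid_normal X m s.

Local Notation sigma_itv a b := (<<s block_rectangles X (ord_itv N a b) >>).
Local Notation walk := (walk X m).

Lemma sigma_itv_indep_ge (a b a' b' : nat) (A E : set T) (x y : R) :
  (b <= a')%N -> 0 <= x -> 0 <= y -> sigma_itv a b A -> sigma_itv a' b' E ->
  (x%:E <= P A)%E -> (y%:E <= P E)%E -> ((x * y)%:E <= P (A `&` E))%E.
Proof.
move=> ba x0 y0 sA sE xA yE.
rewrite (block_indep (proj1 iidX) _ sA sE).
  by rewrite EFinM; apply: lee_pmul.
by move=> i; rewrite !inE => /andP[_ ib]; rewrite negb_and -ltnNge (leq_trans ib).
Qed.

Lemma sigma_itvI (a b : nat) (A E : set T) :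
  sigma_itv a b A -> sigma_itv a b E -> sigma_itv a b (A `&` E).
Proof.
exact: (@measurableI _ (g_sigma_algebraType (block_rectangles X (ord_itv N a b)))).
Qed.

Lemma sigma_itv_walk (a b a' b' : nat) (x y : R) :
  (a' <= a)%N -> (b <= b')%N ->
  sigma_itv a' b' [set w | x <= walk a b w <= y].
Proof.
move=> aa bb; rewrite (_ : [set w | _] = walk a b @^-1` [set` `[x, y]]).
  by apply: measurable_walk.
by apply/seteqP; split => w; rewrite /= in_itv.
Qed.

Lemma walk_itv_ge (a b : nat) (q Q k x y : R) : (b <= N)%N ->
  0 < q -> 0 < Q -> x <= y -> q <= s * Num.sqrt (b - a)%:R <= Q ->
  (forall z, x <= z <= y -> `|z| <= k) ->
  (((y - x) * (normal_peak Q * expR (- (k ^+ 2 / (2 * q ^+ 2)))))%:E <=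
   P [set w | (x <= walk a b w <= y)%R])%E.
Proof.
move=> bN q0 Q0 xy qQ hk.
have := @block_sum_itv_ge _ _ _ _ _ _ _ _ s_gt0 iidX (ord_itv N a b) q Q k x y.
by rewrite card_ord_itv//; apply.
Qed.

(** The windows are [[p1, p2]] and [[p3, p4]], the outer points [p0] and [p5]. Between the windows
    the walk rises by about [e] to a peak at [q1], falls by [2 * e] to a dip at [q2] and rises back.
    The five increments are independent, each in its range with probability at least [rho]; leaving
    a window bound costs at most half of [rho ^+ 5]. *)
Lemma oscillation_event (p0 p1 p2 q1 q2 p3 p4 p5 n : nat) (q Q e u : R) :
  (p0 <= p1 <= p2)%N -> (p2 <= q1 <= q2)%N -> (q2 <= p3 <= p4)%N ->
  (p4 <= p5 <= N)%N ->
  0 < q -> 0 < Q -> 0 < u -> u <= e ->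
  (forall l, l \in [:: p1 - p0; q1 - p2; q2 - q1; p3 - q2; p5 - p4]%N ->
     q <= s * Num.sqrt l%:R <= Q) ->
  (p2 - p1 <= n)%N -> (p4 - p3 <= n)%N ->
  let rho := u * (normal_peak Q * expR (- ((3 * e) ^+ 2 / (2 * q ^+ 2)))) in
  2 * expR (- (3 * (u / 2) ^+ 2 / (8 * (n%:R * s ^+ 2)))) <= rho ^+ 5 / 8 ->
  exists E : set T, [/\ measurable E, ((rho ^+ 5 / 2)%:E <= P E)%E &
    forall w, E w ->
    [/\ `|walk p0 p1 w| <= u /\ `|walk p4 p5 w| <= u,
        forall k, (k <= p2 - p1)%N -> `|walk p1 (p1 + k) w| <= u,
        forall k, (k <= p4 - p3)%N -> `|walk p3 (p3 + k) w| <= u &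
        [/\ e <= walk p2 q1 w <= e + u,
            - (2 * e + u) <= walk q1 q2 w <= - (2 * e) &
            e <= walk q2 p3 w <= e + u]]].
Proof.
move=> /andP[p01 p12] /andP[p2q1 q12] /andP[q2p3 p34] /andP[p45 p5N].
move=> q0 Q0 u0 ue len n12 n34 rho tail.
have e0 : 0 < e by exact: lt_le_trans ue.
have rho0 : 0 <= rho.
  by rewrite mulr_ge0 ?(ltW u0)// mulr_ge0 ?normal_peak_ge0 ?expR_ge0.
(* Every prescribed range has length [u] and lies in [[- 3 e, 3 e]], which explains the form of
   [rho]. *)
have blk a b x y : (b <= N)%N ->
    (b - a \in [:: p1 - p0; q1 - p2; q2 - q1; p3 - q2; p5 - p4])%N ->
    x <= y -> y = x + u -> - (3 * e) <= x -> y <= 3 * e ->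
    (rho%:E <= P [set w | (x <= walk a b w <= y)%R])%E.
  move=> bN lab xy yx x3 y3; rewrite /rho.
  have -> : u = y - x by rewrite yx; ring.
  apply: walk_itv_ge => //; first exact: len.
  by move=> z /andP[xz zy]; rewrite ler_norml; apply/andP; split; lra.
pose F0 := [set w | - (u / 2) <= walk p0 p1 w <= u / 2].
pose F1 := [set w | e <= walk p2 q1 w <= e + u].
pose F2 := [set w | - (2 * e + u) <= walk q1 q2 w <= - (2 * e)].
pose F3 := [set w | e <= walk q2 p3 w <= e + u].
pose F4 := [set w | - (u / 2) <= walk p4 p5 w <= u / 2].
have s4 : sigma_itv p4 N F4 by apply: sigma_itv_walk.
(* The events are nested from the right: each tail of the intersection depends only on indices
   beyond the preceding block, so the factors split off one at a time. *)
have s3 : sigma_itv q2 N (F3 `&` F4).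
  apply: sigma_itvI; apply: sigma_itv_walk => //; nat_lia.
have s2 : sigma_itv q1 N (F2 `&` (F3 `&` F4)).
  by do ![apply: sigma_itvI]; apply: sigma_itv_walk => //; nat_lia.
have s1 : sigma_itv p2 N (F1 `&` (F2 `&` (F3 `&` F4))).
  by do ![apply: sigma_itvI]; apply: sigma_itv_walk => //; nat_lia.
have PF : ((rho ^+ 5)%:E <= P (F0 `&` (F1 `&` (F2 `&` (F3 `&` F4)))))%E.
  have P4 : (rho%:E <= P F4)%E by apply: blk; rewrite ?inE ?eqxx ?orbT//; lra.
  have P3 : (rho%:E <= P F3)%E.
    by apply: blk; rewrite ?inE ?eqxx ?orbT//; first nat_lia; lra.
  have P2 : (rho%:E <= P F2)%E.
    by apply: blk; rewrite ?inE ?eqxx ?orbT//; first nat_lia; lra.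
  have P1 : (rho%:E <= P F1)%E.
    by apply: blk; rewrite ?inE ?eqxx ?orbT//; first nat_lia; lra.
  have P0 : (rho%:E <= P F0)%E.
    by apply: blk; rewrite ?inE ?eqxx ?orbT//; first nat_lia; lra.
  clearbody rho; have rho2 := mulr_ge0 rho0 rho0.
  have rho3 := mulr_ge0 rho0 rho2; have rho4 := mulr_ge0 rho0 rho3.
  have -> : rho ^+ 5 = rho * (rho * (rho * (rho * rho))) by ring.
  apply: (@sigma_itv_indep_ge p0 p1 p2 N) => //.
    exact: sigma_itv_walk.
  apply: (@sigma_itv_indep_ge p2 q1 q1 N) => //.
    exact: sigma_itv_walk.
  apply: (@sigma_itv_indep_ge q1 q2 q2 N) => //.
    exact: sigma_itv_walk.
  apply: (@sigma_itv_indep_ge q2 p3 p4 N) => //.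
  exact: sigma_itv_walk.
pose F := F0 `&` (F1 `&` (F2 `&` (F3 `&` F4))).
have mF : measurable F.
  apply: measurableI; last exact: (measurable_block s1).
  by apply: (@measurable_block _ _ _ _ _ X (ord_itv N p0 p1)); exact: sigma_itv_walk.
have rho1 : rho ^+ 5 <= 1.
  by rewrite -lee_fin (le_trans PF)// probability_le1.
have u2 : 0 < u / 2 by rewrite divr_gt0.
have eta2 : rho ^+ 5 / 8 <= 2^-1 by lra.
(* The maximal inequality doubles the threshold, hence [u / 2]; each exceptional event has
   probability at most [rho ^+ 5 / 4]. *)
have [W1 [mW1 PW1 W1P]] : exists E : set T, [/\ measurable E,
    (P E <= (2 * (rho ^+ 5 / 8))%:E)%E &
    forall w, ~ E w -> forall k, (k <= p2 - p1)%N ->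
      `|walk p1 (p1 + k) w| < 2 * (u / 2)].
  by apply: (@walk_max _ _ _ _ _ _ _ s s_gt0 iidX _ _ n) => //; nat_lia.
have [W2 [mW2 PW2 W2P]] : exists E : set T, [/\ measurable E,
    (P E <= (2 * (rho ^+ 5 / 8))%:E)%E &
    forall w, ~ E w -> forall k, (k <= p4 - p3)%N ->
      `|walk p3 (p3 + k) w| < 2 * (u / 2)].
  by apply: (@walk_max _ _ _ _ _ _ _ s s_gt0 iidX _ _ n) => //; nat_lia.
have uE : 2 * (u / 2) = u by field.
have mW : measurable (W1 `|` W2) by exact: measurableU.
exists (F `\` (W1 `|` W2)); split.
- exact: measurableD.
- have PW : (P (W1 `|` W2) <= (rho ^+ 5 / 2)%:E)%E.
    apply: (le_trans (measureU2 _ mW1 mW2)).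
    apply: (le_trans (leeD PW1 PW2)).
    by rewrite -EFinD lee_fin; lra.
  have : (P F <= P (F `\` (W1 `|` W2)) + P (W1 `|` W2))%E.
    apply: le_trans (measureU2 _ _ mW); last exact: measurableD.
    apply: le_measure; rewrite ?inE//.
      by apply: measurableU => //; exact: measurableD.
    by move=> w Fw; have [Ww|Ww] := pselect ((W1 `|` W2) w); [right|left].
  move=> h; rewrite -(@leeD2rE _ (P (W1 `|` W2))) ?fin_num_measure//.
  apply: le_trans h; apply: le_trans PF.
  apply: (le_trans (leeD2l _ PW)).
  by rewrite -EFinD lee_fin; lra.
- move=> w [[F0w [F1w [F2w [F3w F4w]]]] /not_orP[W1w W2w]].
  split.
  + split; rewrite ler_norml; [move: F0w|move: F4w];
      by rewrite /F0 /F4 /= => /andP[? ?]; apply/andP; split; lra.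
  + by move=> k kp; rewrite -uE ltW// W1P.
  + by move=> k kp; rewrite -uE ltW// W2P.
  + by split.
Qed.
End oscillation.

(** * Optimality conditions of the FLSA *)

Lemma entryE (R : realType) (N : nat) (m : 'cV[R]_N) (i : 'I_N) :
  entry m i.+1 = m i 0.
Proof. by rewrite /entry/= valK. Qed.

Lemma entry_col (R : realType) (N : nat) (F : nat -> R) (t : nat) :
  (1 <= t <= N)%N -> entry (\col_(i < N) F i.+1) t = F t.
Proof.
case: t => // t /= tN.
by rewrite -[t]/(nat_of_ord (Ordinal tN)) entryE mxE.
Qed.

(** The dual variable of the FLSA. The sum stops before [t], so its value at [t] belongs to the
    difference between the entries at [t.-1] and [t]. *)
Definition residual_walk (R : realType) (N : nat) (y m : 'cV[R]_N) (t : nat) : R :=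
  \sum_(1 <= s < t) (entry y s - entry m s).

Lemma residual_walkS (R : realType) (N : nat) (y m : 'cV[R]_N) (t : nat) :
  (1 <= t)%N ->
  residual_walk y m t.+1 = residual_walk y m t + (entry y t - entry m t).
Proof. by move=> t1; rewrite /residual_walk big_nat_recr. Qed.

(* First-order condition for adding the constant [k] to the entries before [t]:
   only the jump at [t] changes. *)
Lemma flsa_perturb (R : realType) (N : nat) (y m : 'cV[R]_N) (lambda k : R)
    (t : nat) :
  is_flsa_estimate y lambda m -> (2 <= t <= N)%N ->
  0 <= - (k * residual_walk y m t) + k ^+ 2 * ((t.-1)%:R / 2)
       + lambda * (`|entry m t - entry m t.-1 - k| - `|entry m t - entry m t.-1|).
Proof.
move=> opt /andP[t2 tN].
pose m' : 'cV[R]_N := \col_(i < N) (entry m i.+1 + if (i.+1 < t)%N then k else 0).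
have m'E s : (1 <= s <= N)%N -> entry m' s = entry m s + if (s < t)%N then k else 0.
  by move=> hs; rewrite (entry_col (fun s => entry m s + if (s < t)%N then k else 0)).
have := opt m'; rewrite -subr_ge0 /flsa_objective.
rewrite opprD addrACA -!mulrBr -!sumrB.
pose D1 s := (entry y s - entry m' s) ^+ 2 - (entry y s - entry m s) ^+ 2.
pose D2 s := `|entry m' s - entry m' s.-1| - `|entry m s - entry m s.-1|.
rewrite -/(\sum_(1 <= s < N.+1) D1 s) -/(\sum_(2 <= s < N.+1) D2 s).
have -> : \sum_(1 <= s < N.+1) D1 s =
    - (2 * k * residual_walk y m t) + k ^+ 2 * (t.-1)%:R.
  have D1_0 : \sum_(t <= s < N.+1) D1 s = 0.
    rewrite big_nat big1// => s /andP[ts sN]; rewrite /D1 m'E; last by lia.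
    by rewrite ltnNge ts addr0 subrr.
  rewrite (@big_cat_nat _ _ _ t)//=; [|exact: ltnW|exact: leqW].
  rewrite D1_0 addr0 /residual_walk mulr_sumr -sumrN.
  have -> : k ^+ 2 * (t.-1)%:R = \sum_(1 <= s < t) k ^+ 2.
    by rewrite sumr_const_nat subn1 mulr_natr.
  rewrite -big_split/=; apply: eq_big_nat => s /andP[s1 st].
  rewrite /D1 m'E; last by lia.
  by rewrite st; ring.
have -> : \sum_(2 <= s < N.+1) D2 s =
    `|entry m t - entry m t.-1 - k| - `|entry m t - entry m t.-1|.
  have D2_lt : \sum_(2 <= s < t) D2 s = 0.
    rewrite big_nat big1// => s /andP[s2 st]; rewrite /D2 !m'E; [|lia|lia].
    rewrite st (leq_ltn_trans (leq_pred _) st).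
    by rewrite opprD addrACA subrr addr0 subrr.
  have D2_gt : \sum_(t.+1 <= s < N.+1) D2 s = 0.
    rewrite big_nat big1// => s /andP[ts sN]; rewrite /D2 !m'E; [|lia|lia].
    rewrite ltnNge (ltnW ts) /= ifF; last by lia.
    by rewrite !addr0 subrr.
  rewrite (@big_cat_nat _ _ _ t)//=; last exact: leqW.
  rewrite D2_lt add0r big_ltn//= D2_gt addr0 /D2 !m'E; [|lia|lia].
  rewrite ltnn prednK; last by lia.
  by rewrite leqnn addr0 opprD addrA.
by congr (0 <= _ + _); field.
Qed.

(** Letting [k] tend to 0; this removes the quadratic term of a perturbation. *)
Lemma le0_small_slope (R : realType) (x c b : R) : 0 <= c -> 0 < b ->
  (forall k, 0 < k <= b -> x <= k * c) -> x <= 0.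
Proof.
move=> c0 b0 H; rewrite leNgt; apply/negP => x0.
have c1 : 0 < c + 1 by lra.
pose k := Num.min b (x / (c + 1)).
have k0 : 0 < k by rewrite lt_min b0 divr_gt0.
have := H k; rewrite k0 ge_min lexx => /(_ isT) xk.
have : k * c <= x / (c + 1) * c by rewrite ler_wpM2r// ge_min lexx orbT.
have -> : x / (c + 1) * c = x - x / (c + 1) by field; rewrite gt_eqF.
have : 0 < x / (c + 1) by rewrite divr_gt0.
lra.
Qed.

Section optimality.
Variables (R : realType) (N : nat) (y m : 'cV[R]_N) (lambda : R) (t : nat).
Hypothesis lambda_gt0 : 0 < lambda.
Hypothesis opt : is_flsa_estimate y lambda m.
Hypothesis tN : (2 <= t <= N)%N.
Let V := residual_walk y m t.
Let dm := entry m t - entry m t.-1.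
Let c : R := (t.-1)%:R / 2.
Let c0 : 0 <= c. Proof. by rewrite divr_ge0. Qed.
Let pert k : 0 <= - (k * V) + k ^+ 2 * c + lambda * (`|dm - k| - `|dm|).
Proof. exact: flsa_perturb. Qed.

Let pert_div (x k : R) : 0 < k -> k * x <= k ^+ 2 * c -> x <= k * c.
Proof. by move=> k0; rewrite expr2 -mulrA ler_pM2l. Qed.

(** A perturbation by [k] raises the penalty by at most [lambda] times its size; the two signs of
    [k] give the two bounds. *)
Lemma residual_walk_le : `|V| <= lambda.
Proof.
have tri k : `|dm - k| - `|dm| <= `|k|.
  by rewrite lerBlDr (le_trans (ler_normB _ _))// addrC.
rewrite ler_norml lerNl; apply/andP; split; rewrite -subr_le0.
  apply: (le0_small_slope c0 ltr01) => k /andP[k0 _]; apply: pert_div => //.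
  have := pert (- k); have := ler_wpM2l (ltW lambda_gt0) (tri (- k)).
  rewrite normrN (gtr0_norm k0); lra.
apply: (le0_small_slope c0 ltr01) => k /andP[k0 _]; apply: pert_div => //.
have := pert k; have := ler_wpM2l (ltW lambda_gt0) (tri k).
rewrite (gtr0_norm k0); lra.
Qed.

(** Shrinking an upward jump by a small [k] saves exactly [lambda * k], and optimality forbids a net
    gain to first order. *)
Lemma residual_walk_up : entry m t.-1 < entry m t -> V <= - lambda.
Proof.
rewrite -subr_gt0 -/dm => d0; rewrite -subr_le0 opprK.
apply: (le0_small_slope c0 d0) => k /andP[k0 kd]; apply: pert_div => //.
have := pert k; rewrite (ger0_norm (ltW d0)) ger0_norm ?subr_ge0//; lra.
Qed.

Lemma residual_walk_down : entry m t < entry m t.-1 -> lambda <= V.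
Proof.
rewrite -subr_lt0 -/dm => d0; rewrite -subr_le0.
have d0' : 0 < - dm by rewrite oppr_gt0.
apply: (le0_small_slope c0 d0') => k /andP[k0 kd]; apply: pert_div => //.
have := pert (- k); rewrite (ltr0_norm d0) opprK ler0_norm; last by lra.
lra.
Qed.
End optimality.

(** * Incompatible shapes of the noise walk *)

Lemma telescope_ge (R : realFieldType) (f : nat -> R) (k : R) (s t : nat) :
  (s <= t)%N -> (forall i, (s <= i < t)%N -> k <= f i.+1 - f i) ->
  k * (t%:R - s%:R) <= f t - f s.
Proof.
elim: t => [|t IH]; first by rewrite leqn0 => /eqP -> _; rewrite !subrr mulr0.
rewrite leq_eqVlt => /orP[/eqP -> _|st h]; first by rewrite !subrr mulr0.
have h1 : k <= f t.+1 - f t by apply: h; lia.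
have : k * (t%:R - s%:R) <= f t - f s by apply: IH => // i hi; apply: h; lia.
rewrite -(natr1 t); lra.
Qed.

Lemma telescope_le (R : realFieldType) (f : nat -> R) (k : R) (s t : nat) :
  (s <= t)%N -> (forall i, (s <= i < t)%N -> f i.+1 - f i <= k) ->
  f t - f s <= k * (t%:R - s%:R).
Proof.
move=> st h; have := @telescope_ge _ (fun i => - f i) (- k) s t st.
have h' i : (s <= i < t)%N -> - k <= - f i.+1 - - f i by move=> /h; lra.
move=> /(_ h'); lra.
Qed.

(** The hypothesis on [x * q] comes from an outer point at distance [H]; the conclusion transfers it
    to a stretch of length [p] between the windows. For [x >= 0] both terms scale down directly. For
    [x < 0], [3 * W <= H] gives [H + W <= 2 * (H - W)], so [J - 2 * - x] is small, while
    [x * p <= 2 * x * W]. *)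
Lemma slope_bound (R : realFieldType) (x J p q W H de K : R) :
  0 <= J -> 0 <= W -> 0 < H -> 3 * W <= H -> 0 <= de -> 0 <= K ->
  H - W <= q <= H + W -> 2 * W <= p -> p <= K * (H - W) ->
  x * q + J * (H - W) <= 2 * de -> x * p + J * W <= (2 * K + 2) * de.
Proof.
move=> J0 W0 H0 WH de0 K0 /andP[q1 q2] p1 p2 hx.
have E0 : 0 < H - W by lra.
have Kde0 : 0 <= K * de by rewrite mulr_ge0.
have WE : W * 2 <= H - W by lra.
have [x0|x0] := leP 0 x.
  have h1 := ler_wpM2l x0 q1.
  have h2 := ler_wpM2l x0 p2.
  have h3 := ler_wpM2l J0 WE.
  have h4 : 0 <= J * (H - W) by rewrite mulr_ge0// ltW.
  have h5 : K * (x * (H - W)) <= K * (2 * de) by apply: ler_wpM2l; lra.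
  have h6 : 0 <= x * (H - W) by rewrite mulr_ge0// ltW.
  lra.
have x0' : 0 <= - x by lra.
have h1 := ler_wpM2l x0' q2.
have h2 := ler_wpM2l x0' p1.
have h3 : J * (H - W) <= (2 * de + 2 * - x * (H - W)).
  have : 0 <= - x * (H - 3 * W) by rewrite mulr_ge0// subr_ge0.
  lra.
have h4 : (J - 2 * - x) * W <= de.
  have [J2|J2] := leP (J - 2 * - x) 0.
    by rewrite (le_trans _ de0)// mulr_le0_ge0.
  have := ler_wpM2l (ltW J2) WE; lra.
lra.
Qed.

(* While the level of [m] stays at most [r], the partial sums cannot fall from
   [lam] to [- lam] within the window, so that no upward jump ends this stretch
   before [B + h]. *)
Lemma down_jump_right (R : realFieldType) (V g ss mm : nat -> R)
    (B h w b : nat) (lam be ga r delta : R) :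
  let x := be - r in
  (w < h)%N -> (B - w <= b <= B + w)%N ->
  (forall t, (B - w <= t < B + h)%N ->
     V t.+1 - V t = ss t - mm t + (g t.+1 - g t)) ->
  (forall t, (B - w < t <= B + h)%N -> mm t.-1 < mm t -> V t <= - lam) ->
  (forall t, (B - w < t <= B + h)%N -> mm t != mm t.-1 -> (t <= B + w)%N) ->
  (forall t, (B - w <= t < B)%N -> ss t = be) ->
  (forall t, (B <= t < B + h)%N -> ss t = ga) ->
  be <= ga ->
  (forall t, (B - w <= t <= B + w)%N -> `|g t - g B| <= delta) ->
  `|g (B + h)%N - g B| <= delta ->
  `|x| * (2 * w%:R) + 2 * delta < 2 * lam ->
  mm b < r -> lam <= V b -> V (B + h)%N <= lam ->
  x * (h%:R + (B%:R - b%:R)) + (ga - be) * (h%:R - w%:R) <= 2 * delta.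
Proof.
move=> x wh bB rec up loc ss_be ss_ga bega gB gBh xw_lt bdown lamb VBh.
pose f t := V t - g t.
have f_rec t : (B - w <= t < B + h)%N -> f t.+1 - f t = ss t - mm t.
  by move=> /rec; rewrite /f; real_lra.
have gB_b : `|g b - g B| <= delta by exact: gB.
have w0 : 0 <= w%:R :> R by [].
have fb_ge t : (b <= t <= B + h)%N ->
    (forall i, (b <= i < t)%N -> mm i <= r) ->
    x * (t%:R - b%:R) <= f t - f b.
  move=> /andP[bt tBh] hi; apply: telescope_ge => // i hit.
  rewrite f_rec; last by nat_lia.
  have := hi _ hit; have [iB|Bi] := ltnP i B.
    by rewrite ss_be /x; [real_lra|nat_lia].
  by rewrite ss_ga /x; [real_lra|nat_lia].
have mm_le t : (b <= t <= B + h)%N -> mm t <= r.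
  have [n] := ubnP t; elim: n t => // n IH t tn ht.
  have [->|bt] := eqVneq t b; first exact: ltW.
  have IHt i : (b <= i < t)%N -> mm i <= r by move=> hi; apply: IH; nat_lia.
  rewrite leNgt; apply/negP => rt.
  have mt : mm t.-1 < mm t.
    by apply: le_lt_trans rt; apply: IHt; nat_lia.
  have Vt : V t <= - lam by apply: up => //; nat_lia.
  have tB : (B - w <= t <= B + w)%N.
    by have := loc t ltac:(nat_lia) (negbT (gt_eqF mt)); nat_lia.
  have fbt := fb_ge t ht IHt.
  have tb : `|t%:R - b%:R| <= 2 * w%:R :> R.
    have h1 : t%:R <= (b + 2 * w)%:R :> R by rewrite ler_nat; nat_lia.
    have h2 : b%:R <= (t + 2 * w)%:R :> R by rewrite ler_nat; nat_lia.
    rewrite ler_norml; move: h1 h2.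
    by rewrite (natrD _ b) (natrD _ t) !natrM; real_lra.
  have gt := gB t tB.
  have := ler_wpM2l (normr_ge0 x) tb; rewrite -normrM => xtb.
  move: fbt gt gB_b (ler_norm (- (x * (t%:R - b%:R)))).
  rewrite normrN /f !ler_norml => ? /andP[? ?] /andP[? ?] ?.
  by real_lra.
have fBh : x * (h%:R + (B%:R - b%:R)) + (ga - be) * (h%:R - w%:R) <=
    f (B + h)%N - f b.
  have bega' : 0 <= ga - be by rewrite subr_ge0.
  have tail s : (B <= s <= B + h)%N -> (b <= s)%N ->
      (x + (ga - be)) * ((B + h)%:R - s%:R) <= f (B + h)%N - f s.
    move=> /andP[Bs sBh] bs; apply: telescope_ge => // i hi.
    rewrite f_rec; last by nat_lia.
    have := mm_le i; rewrite ss_ga /x; last by nat_lia.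
    move=> /(_ _) mi; have : mm i <= r by apply: mi; nat_lia.
    by real_lra.
  (* The true jump [ga - be] acts for all [h] steps if [b <= B], and for at least [h - w] steps
     otherwise. *)
  have [bB'|Bb] := leqP b B.
    have := tail B; rewrite leqnn leq_addr bB' natrD => /(_ isT isT).
    have := fb_ge B; rewrite bB' leq_addr => /(_ isT) hB.
    have : x * (B%:R - b%:R) <= f B - f b.
      by apply: hB => i hi; apply: mm_le; nat_lia.
    have := mulr_ge0 bega' w0; real_lra.
  have := tail b; rewrite leqnn (ltnW Bb) natrD => hb.
  have : (x + (ga - be)) * (B%:R + h%:R - b%:R) <= f (B + h)%N - f b.
    by apply: hb => //; nat_lia.
  have bw : b%:R - B%:R <= w%:R :> R.
    by rewrite lerBlDl -natrD ler_nat; nat_lia.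
  have := ler_wpM2l bega' bw; real_lra.
move: fBh gB_b gBh; rewrite /f !ler_norml => ? /andP[? ?] /andP[? ?].
by real_lra.
Qed.

(** The mirror image of [down_jump_right]: going left from the downward jump at [a], the level of
    [m] stays at least [r], since an upward jump there would make the partial sums climb from
    [- lam] to [lam] within the window. *)
Lemma down_jump_left (R : realFieldType) (V g ss mm : nat -> R)
    (A h w a : nat) (lam al be r delta : R) :
  let x := be - r in
  (w < h)%N -> (h <= A)%N -> (A - w <= a <= A + w)%N ->
  (forall t, (A - h <= t < A + w)%N ->
     V t.+1 - V t = ss t - mm t + (g t.+1 - g t)) ->
  (forall t, (A - h < t <= A + w)%N -> mm t.-1 < mm t -> V t <= - lam) ->
  (forall t, (A - h < t <= A + w)%N -> mm t != mm t.-1 -> (A - w <= t)%N) ->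
  (forall t, (A - h <= t < A)%N -> ss t = al) ->
  (forall t, (A <= t < A + w)%N -> ss t = be) ->
  al <= be ->
  (forall t, (A - w <= t <= A + w)%N -> `|g t - g A| <= delta) ->
  `|g (A - h)%N - g A| <= delta ->
  `|x| * (2 * w%:R) + 2 * delta < 2 * lam ->
  r < mm a.-1 -> lam <= V a -> V (A - h)%N <= lam ->
  - x * (h%:R + (a%:R - A%:R)) + (be - al) * (h%:R - w%:R) <= 2 * delta.
Proof.
move=> x wh hA aA rec up loc ss_al ss_be albe gA gAh xw_lt adown lama VAh.
pose f t := V t - g t.
have f_rec t : (A - h <= t < A + w)%N -> f t.+1 - f t = ss t - mm t.
  by move=> /rec; rewrite /f; real_lra.
have gA_a : `|g a - g A| <= delta by exact: gA.
have w0 : 0 <= w%:R :> R by [].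
have fa_le t : (A - h <= t <= a)%N ->
    (forall i, (t <= i < a)%N -> r <= mm i) ->
    f a - f t <= x * (a%:R - t%:R).
  move=> /andP[Aht ta] hi; apply: telescope_le => // i hit.
  rewrite f_rec; last by nat_lia.
  have := hi _ hit; have [iA|Ai] := ltnP i A.
    by rewrite ss_al /x; [real_lra|nat_lia].
  by rewrite ss_be /x; [real_lra|nat_lia].
have mm_ge t : (A - h <= t < a)%N -> r <= mm t.
  have [n] := ubnP (a - t)%N; elim: n t => // n IH t tn ht.
  have [at_|at_] := eqVneq a t.+1; first by move: adown; rewrite at_; exact: ltW.
  have IHt i : (t.+1 <= i < a)%N -> r <= mm i by move=> hi; apply: IH; nat_lia.
  rewrite leNgt; apply/negP => tr.
  have mt : mm t < mm t.+1 by apply: lt_le_trans tr _; apply: IHt; nat_lia.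
  have Vt : V t.+1 <= - lam by apply: up => //; nat_lia.
  have tA : (A - w <= t.+1 <= A + w)%N.
    by have := loc t.+1 ltac:(nat_lia) (negbT (gt_eqF mt)); nat_lia.
  have ht1 : (A - h <= t.+1 <= a)%N by nat_lia.
  have fat := fa_le t.+1 ht1 IHt.
  have ta : `|a%:R - t.+1%:R| <= 2 * w%:R :> R.
    have h1 : t.+1%:R <= (a + 2 * w)%:R :> R by rewrite ler_nat; nat_lia.
    have h2 : a%:R <= (t.+1 + 2 * w)%:R :> R by rewrite ler_nat; nat_lia.
    rewrite ler_norml; move: h1 h2.
    by rewrite (natrD _ a) (natrD _ t.+1) !natrM; real_lra.
  have gt := gA t.+1 tA.
  have := ler_wpM2l (normr_ge0 x) ta; rewrite -normrM => xta.
  move: fat gt gA_a (ler_norm (x * (a%:R - t.+1%:R))).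
  rewrite /f !ler_norml => ? /andP[? ?] /andP[? ?] ?.
  by real_lra.
have fAh : f a - f (A - h)%N <=
    x * (h%:R + (a%:R - A%:R)) - (be - al) * (h%:R - w%:R).
  have albe' : 0 <= be - al by rewrite subr_ge0.
  have hAh : (A - h)%:R = A%:R - h%:R :> R by rewrite natrB.
  have tail t : (A - h <= t <= A)%N -> (t <= a)%N ->
      f t - f (A - h)%N <= (x - (be - al)) * (t%:R - (A - h)%:R).
    move=> /andP[Aht tA] ta; apply: telescope_le => // i hi.
    rewrite f_rec; last by nat_lia.
    have : r <= mm i by apply: mm_ge; nat_lia.
    rewrite ss_al /x; last by nat_lia.
    by real_lra.
  have [Aa|aA'] := leqP A a.
    have h1 : f A - f (A - h)%N <= (x - (be - al)) * (A%:R - (A - h)%:R).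
      by apply: tail; rewrite ?leq_subr ?leqnn.
    have h2 : f a - f A <= x * (a%:R - A%:R).
      by apply: fa_le => [|i hi]; [nat_lia|apply: mm_ge; nat_lia].
    have := mulr_ge0 albe' w0; rewrite hAh in h1; real_lra.
  have h1 : f a - f (A - h)%N <= (x - (be - al)) * (a%:R - (A - h)%:R).
    by apply: tail; nat_lia.
  have aw : A%:R - a%:R <= w%:R :> R.
    by rewrite lerBlDr -natrD ler_nat; nat_lia.
  have := ler_wpM2l albe' aw; rewrite hAh in h1; real_lra.
move: fAh gA_a gAh; rewrite /f !ler_norml => ? /andP[? ?] /andP[? ?].
by real_lra.
Qed.

(** The deterministic core for two upward true jumps. The sequences are abstract, so that negating
    all of them covers two downward jumps. [K] compares the distance of the change points with that
    of the outer points. *)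
Lemma no_taut_string_match (R : realFieldType) (V g ss mm : nat -> R)
    (A B h w tau1 tau2 : nat) (lam al be ga delta D K : R) :
  (h <= A)%N ->
  (forall t, (A - h <= t < B + h)%N ->
     V t.+1 - V t = ss t - mm t + (g t.+1 - g t)) ->
  (forall t, (A - h <= t <= B + h)%N -> `|V t| <= lam) ->
  (forall t, (A - h < t <= B + h)%N -> mm t.-1 < mm t -> V t <= - lam) ->
  (forall t, (A - h < t <= B + h)%N -> mm t < mm t.-1 -> lam <= V t) ->
  (forall t, (A - h < t <= B + h)%N -> mm t != mm t.-1 ->
     (A - w <= t <= A + w)%N \/ (B - w <= t <= B + w)%N) ->
  (exists t, (A - w <= t <= A + w)%N && (mm t != mm t.-1)) ->
  (exists t, (B - w <= t <= B + w)%N && (mm t != mm t.-1)) ->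
  (forall t, (A - h <= t < A)%N -> ss t = al) ->
  (forall t, (A <= t < B)%N -> ss t = be) ->
  (forall t, (B <= t < B + h)%N -> ss t = ga) ->
  al <= be -> be <= ga ->
  (3 * w < h)%N -> (A + 10 * w < B)%N ->
  (A + 3 * w <= tau1 <= B - w)%N -> (A + 3 * w <= tau2 <= B - w)%N ->
  0 <= K -> B%:R - A%:R + 2 * w%:R <= K * (h%:R - w%:R) ->
  0 < delta -> (2 * K + 8) * delta <= D ->
  (forall t, (A - w <= t <= A + w)%N -> `|g t - g A| <= delta) ->
  (forall t, (B - w <= t <= B + w)%N -> `|g t - g B| <= delta) ->
  `|g B - g A| <= delta ->
  `|g (A - h)%N - g A| <= delta -> `|g (B + h)%N - g B| <= delta ->
  D <= g tau1 - g A -> D <= g A - g tau2 ->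
  False.
Proof.
move=> hA rec V_le up down loc exA exB ss_al ss_be ss_ga albe bega wh AB.
move=> tau1_mid tau2_mid K0 AB_K delta0 D_ge gA gB gAB gAh gBh g1 g2.
(* With [a] the last jump in the left window and [b] the first in the right one, [m] is constant on
   [[a, b)]. *)
have [a [aA mma alast]] : exists a, [/\ (A - w <= a <= A + w)%N,
    mm a != mm a.-1 & forall t, (a < t <= A + w)%N -> mm t = mm t.-1].
  have ub t : (A - w <= t <= A + w)%N && (mm t != mm t.-1) -> (t <= A + w)%N.
    by case/andP => /andP[].
  case: (ex_maxnP exA ub) => a /andP[aA mma] amax.
  exists a; split => // t ht; apply/eqP/negP => /negP ne.
  by have := amax t; rewrite ne andbT; nat_lia.
have [b [bB mmb bfirst]] : exists b, [/\ (B - w <= b <= B + w)%N,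
    mm b != mm b.-1 & forall t, (B - w <= t < b)%N -> mm t = mm t.-1].
  case: (ex_minnP exB) => b /andP[bB mmb] bmin.
  exists b; split => // t ht; apply/eqP/negP => /negP ne.
  by have := bmin t; rewrite ne andbT; nat_lia.
pose f t := V t - g t.
have f_rec t : (A - h <= t < B + h)%N -> f t.+1 - f t = ss t - mm t.
  by move=> /rec; rewrite /f; real_lra.
pose r := mm a.
have const t : (a <= t < b)%N -> mm t = r.
  elim: t => [|t IH] ht; first by rewrite /r; congr mm; nat_lia.
  have [ta|ta] := eqVneq a t.+1; first by rewrite /r ta.
  rewrite -IH; last by nat_lia.
  apply/eqP/negP => /negP ne.
  have /loc : (A - h < t.+1 <= B + h)%N by nat_lia.
  move=> /(_ ne) [tw|tw].
    by move: ne; rewrite alast ?eqxx//; nat_lia.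
  by move: ne; rewrite bfirst ?eqxx//; nat_lia.
have mmb1 : mm b.-1 = r by apply: const; nat_lia.
set x := be - r.
have w0 : 0 <= w%:R :> R by [].
have f_mid s t : (a <= s)%N -> (A <= s)%N -> (s <= t)%N -> (t <= b)%N ->
    (t <= B)%N -> f t - f s = x * (t%:R - s%:R).
  move=> as_ As st tb tB.
  have e i : (s <= i < t)%N -> f i.+1 - f i = x.
    move=> hi; rewrite f_rec; last by nat_lia.
    by rewrite ss_be ?const//; nat_lia.
  apply/eqP; rewrite eq_le; apply/andP; split.
    by apply: telescope_le => // i /e ->.
  by apply: telescope_ge => // i /e ->.
(* Between the windows [f] is affine with slope [x]. Inside them the true jumps disturb this in one
   direction only, for at most [w] steps. *)
have f_b_ge s : (A <= s)%N -> (a <= s <= b)%N ->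
    x * (b%:R - s%:R) <= f b - f s.
  move=> As /andP[as_ sb]; apply: telescope_ge => // i hi.
  rewrite f_rec; last by nat_lia.
  rewrite const ?lerB//; last by nat_lia.
  have [iB|Bi] := ltnP i B; first by rewrite ss_be//; nat_lia.
  by rewrite ss_ga//; nat_lia.
have f_b_le s : (A <= s <= B)%N -> (a <= s <= b)%N ->
    f b - f s <= x * (b%:R - s%:R) + (ga - be) * w%:R.
  move=> /andP[As sB] /andP[as_ sb].
  have [bB'|Bb] := leqP b B.
    by rewrite f_mid// lerDl mulr_ge0// subr_ge0.
  have e : f B - f s = x * (B%:R - s%:R) by apply: f_mid; rewrite // ltnW.
  have e2 : f b - f B <= (ga - r) * (b%:R - B%:R).
    apply: telescope_le; first exact: ltnW.
    move=> i hi; rewrite f_rec; last by nat_lia.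
    by rewrite const ?ss_ga//; nat_lia.
  have bw : b%:R - B%:R <= w%:R :> R.
    by rewrite lerBlDl -natrD ler_nat; nat_lia.
  have bega' : 0 <= ga - be by rewrite subr_ge0.
  have := ler_wpM2l bega' bw; rewrite /x in e *; real_lra.
have f_a_le t : (a <= t <= b)%N -> (t <= B)%N ->
    f t - f a <= x * (t%:R - a%:R).
  move=> /andP[at_ tb] tB; apply: telescope_le => // i hi.
  rewrite f_rec; last by nat_lia.
  rewrite const ?lerB//; last by nat_lia.
  have [iA|Ai] := ltnP i A; first by rewrite ss_al//; nat_lia.
  by rewrite ss_be//; nat_lia.
have f_a_ge t : (a <= t <= b)%N -> (A <= t <= B)%N ->
    x * (t%:R - a%:R) - (be - al) * w%:R <= f t - f a.
  move=> /andP[at_ tb] /andP[At tB].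
  have [Aa|aA'] := leqP A a.
    by rewrite f_mid// lerBlDr lerDl mulr_ge0// subr_ge0.
  have e : f t - f A = x * (t%:R - A%:R) by apply: f_mid; rewrite // ltnW.
  have e2 : (al - r) * (A%:R - a%:R) <= f A - f a.
    apply: telescope_ge; first exact: ltnW.
    move=> i hi; rewrite f_rec; last by nat_lia.
    by rewrite const ?ss_al//; nat_lia.
  have aw : A%:R - a%:R <= w%:R :> R.
    by rewrite lerBlDr -natrD ler_nat; nat_lia.
  have albe' : 0 <= be - al by rewrite subr_ge0.
  have := ler_wpM2l albe' aw; rewrite /x in e *; real_lra.
have V2 s t : (A - h <= s <= B + h)%N -> (A - h <= t <= B + h)%N ->
    V t - V s <= 2 * lam.
  move=> /V_le + /V_le; rewrite !ler_norml => /andP[? ?] /andP[? ?].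
  by real_lra.
have gA_pA : `|g (A + w)%N - g A| <= delta by apply: gA; nat_lia.
have gB_pB : `|g (B - w)%N - g B| <= delta by apply: gB; nat_lia.
have gA_a : `|g a - g A| <= delta by exact: gA.
have gB_b : `|g b - g B| <= delta by exact: gB.
(* The drift [x] cannot cancel both extremes: for [x >= 0] the rise to the peak must fit into the
   tube of width [2 * lam], for [x < 0] the fall to the dip. *)
have lam_ge : D - delta <= 2 * lam.
  have e1 : f tau1 - f (A + w)%N = x * (tau1%:R - (A + w)%:R).
    by apply: f_mid; nat_lia.
  have e2 : f tau2 - f (A + w)%N = x * (tau2%:R - (A + w)%:R).
    by apply: f_mid; nat_lia.
  have v1 : V tau1 - V (A + w)%N <= 2 * lam by apply: V2; nat_lia.
  have v2 : V (A + w)%N - V tau2 <= 2 * lam by apply: V2; nat_lia.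
  have t1 : 0 <= tau1%:R - (A + w)%:R :> R by rewrite subr_ge0 ler_nat; nat_lia.
  have t2 : 0 <= tau2%:R - (A + w)%:R :> R by rewrite subr_ge0 ler_nat; nat_lia.
  move: gA_pA e1 e2; rewrite ler_norml /f => /andP[? ?] ? ?.
  have [x0|x0] := leP 0 x.
    have := mulr_ge0 x0 t1; real_lra.
  have := mulr_le0_ge0 (ltW x0) t2; real_lra.
have L_ge : 8 * w%:R <= B%:R - A%:R - 2 * w%:R :> R.
  have : (A + 10 * w)%:R <= B%:R :> R by rewrite ler_nat ltnW.
  by rewrite natrD natrM; real_lra.
have x_le : `|x| * (B%:R - A%:R - 2 * w%:R) <= 2 * lam + 3 * delta.
  have e : f (B - w)%N - f (A + w)%N = x * ((B - w)%:R - (A + w)%:R).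
    by apply: f_mid; nat_lia.
  have v1 : V (B - w)%N - V (A + w)%N <= 2 * lam by apply: V2; nat_lia.
  have v2 : V (A + w)%N - V (B - w)%N <= 2 * lam by apply: V2; nat_lia.
  have -> : B%:R - A%:R - 2 * w%:R = (B - w)%:R - (A + w)%:R :> R.
    by rewrite natrB ?natrD; [ring|nat_lia].
  have L0 : 0 <= (B - w)%:R - (A + w)%:R :> R.
    by rewrite subr_ge0 ler_nat; nat_lia.
  rewrite -[X in _ * X]ger0_norm// -normrM -e ler_norml.
  move: gA_pA gB_pB gAB.
  rewrite !ler_norml /f => /andP[? ?] /andP[? ?] /andP[? ?].
  by apply/andP; split; real_lra.
have Kd0 : 0 <= K * delta by rewrite mulr_ge0// ltW.
(* The windows are at least [8 * w] apart, so the drift over [2 * w] steps is at most a quarter of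
   [2 * lam + 3 * delta], and [lam_ge] gives [2 * lam >= 7 * delta]. *)
have xw_lt : `|x| * (2 * w%:R) + 2 * delta < 2 * lam.
  have := ler_wpM2l (normr_ge0 x) L_ge; real_lra.
have wh' : 3 * w%:R <= h%:R :> R by rewrite -natrM ler_nat ltnW.
have h0 : 0 < h%:R :> R by rewrite ltr0n; nat_lia.
have b_down : mm b < r ->
    x * (h%:R + (B%:R - b%:R)) + (ga - be) * (h%:R - w%:R) <= 2 * delta.
  move=> bdown.
  apply: (@down_jump_right _ V g ss mm B h w b lam be ga r delta) => //.
  - by nat_lia.
  - by move=> t ht; apply: rec; nat_lia.
  - by move=> t ht; apply: up; nat_lia.
  - by move=> t ht /loc-/(_ ltac:(nat_lia)); nat_lia.
  - by move=> t ht; apply: ss_be; nat_lia.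
  - by apply: down; rewrite ?mmb1//; nat_lia.
  - by rewrite (le_trans (ler_norm _))// V_le//; nat_lia.
have a_down : r < mm a.-1 ->
    - x * (h%:R + (a%:R - A%:R)) + (be - al) * (h%:R - w%:R) <= 2 * delta.
  move=> adown.
  apply: (@down_jump_left _ V g ss mm A h w a lam al be r delta) => //.
  - by nat_lia.
  - by move=> t ht; apply: rec; nat_lia.
  - by move=> t ht; apply: up; nat_lia.
  - by move=> t ht /loc-/(_ ltac:(nat_lia)); nat_lia.
  - by move=> t ht; apply: ss_be; nat_lia.
  - by apply: down => //; nat_lia.
  - by rewrite (le_trans (ler_norm _))// V_le//; nat_lia.
have ab_ge : 2 * w%:R <= b%:R - a%:R :> R.
  have : (a + 2 * w)%:R <= b%:R :> R by rewrite ler_nat; nat_lia.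
  by rewrite natrD natrM; real_lra.
have ab_le : b%:R - a%:R <= K * (h%:R - w%:R).
  have : (b + A)%:R <= (B + a + 2 * w)%:R :> R by rewrite ler_nat; nat_lia.
  by rewrite natrD (natrD _ (B + a)) (natrD _ B) natrM; real_lra.
have qb : h%:R - w%:R <= (h%:R + (B%:R - b%:R) : R) <= h%:R + w%:R.
  have h1 : b%:R <= (B + w)%:R :> R by rewrite ler_nat; nat_lia.
  have h2 : B%:R <= (b + w)%:R :> R by rewrite ler_nat; nat_lia.
  by apply/andP; move: h1 h2; rewrite !natrD; split; real_lra.
have qa : h%:R - w%:R <= (h%:R + (a%:R - A%:R) : R) <= h%:R + w%:R.
  have h1 : a%:R <= (A + w)%:R :> R by rewrite ler_nat; nat_lia.
  have h2 : A%:R <= (a + w)%:R :> R by rewrite ler_nat; nat_lia.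
  by apply/andP; move: h1 h2; rewrite !natrD; split; real_lra.
have Jb : 0 <= ga - be by rewrite subr_ge0.
have Ja : 0 <= be - al by rewrite subr_ge0.
have pA_b : f b - f (A + w)%N <= x * (b%:R - (A + w)%:R) + (ga - be) * w%:R.
  by apply: f_b_le; nat_lia.
have pA_b' : x * (b%:R - (A + w)%:R) <= f b - f (A + w)%N.
  by apply: f_b_ge; nat_lia.
have a_pA : f (A + w)%N - f a <= x * ((A + w)%:R - a%:R).
  by apply: f_a_le; nat_lia.
have a_pA' : x * ((A + w)%:R - a%:R) - (be - al) * w%:R <= f (A + w)%N - f a.
  by apply: f_a_ge; nat_lia.
clear L_ge x_le xw_lt gA_pA gB_pB AB_K gAh gBh albe bega; clearbody x.
have [aup|adown] : mm a.-1 < r \/ r < mm a.-1.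
  by apply/orP; rewrite -neq_lt eq_sym.
- have Va : V a <= - lam by apply: up => //; nat_lia.
  have [bdown|bup] : mm b < r \/ r < mm b.
    by apply/orP; rewrite -neq_lt -mmb1.
  (* Up, then down: [V] climbs by [2 * lam] from [a] to [b], but [slope_bound] allows only
     [(2 * K + 5) * delta], less than [D - delta]. *)
  + have Vb : lam <= V b by apply: down; rewrite ?mmb1//; nat_lia.
    have := slope_bound Jb w0 h0 wh' (ltW delta0) K0 qb ab_ge ab_le (b_down bdown).
    move: pA_b a_pA gB_b gA_a gAB.
    rewrite /f !ler_norml => ? ? /andP[? ?] /andP[? ?] /andP[? ?].
    by real_lra.
  (* Up twice: [V] starts and ends at its minimum [- lam], and whatever the sign of [x], the dip at
     [tau2] would take it lower. *)
  + have Vb : V b <= - lam by apply: up; rewrite ?mmb1//; nat_lia.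
    have V2lo : - lam <= V tau2.
      have : `|V tau2| <= lam by apply: V_le; nat_lia.
      by rewrite ler_norml => /andP[].
    have h1 : f tau2 - f a <= x * (tau2%:R - a%:R) by apply: f_a_le; nat_lia.
    have h2 : x * (b%:R - tau2%:R) <= f b - f tau2 by apply: f_b_ge; nat_lia.
    have t1 : 0 <= tau2%:R - a%:R :> R by rewrite subr_ge0 ler_nat; nat_lia.
    have t2 : 0 <= b%:R - tau2%:R :> R by rewrite subr_ge0 ler_nat; nat_lia.
    move: gB_b gA_a gAB h1 h2.
    rewrite /f !ler_norml => /andP[? ?] /andP[? ?] /andP[? ?] ? ?.
    have [x0|x0] := leP 0 x; first by have := mulr_ge0 x0 t2; real_lra.
    by have := mulr_le0_ge0 (ltW x0) t1; real_lra.
- have Va : lam <= V a by apply: down => //; nat_lia.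
  have [bdown|bup] : mm b < r \/ r < mm b.
    by apply/orP; rewrite -neq_lt -mmb1.
  (* Down twice: [V] starts at its maximum [lam], and the bounded drift cannot offset the peak at
     [tau1]. *)
  + have V1 : V tau1 <= lam.
      have : `|V tau1| <= lam by apply: V_le; nat_lia.
      by rewrite ler_norml => /andP[].
    have h1 : x * (tau1%:R - a%:R) - (be - al) * w%:R <= f tau1 - f a.
      by apply: f_a_ge; nat_lia.
    have p_ge : 2 * w%:R <= tau1%:R - a%:R :> R.
      have : (a + 2 * w)%:R <= tau1%:R :> R by rewrite ler_nat; nat_lia.
      by rewrite natrD natrM; real_lra.
    have p_le : tau1%:R - a%:R <= K * (h%:R - w%:R).
      have : tau1%:R <= b%:R :> R by rewrite ler_nat; nat_lia.
      by real_lra.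
    have := slope_bound Ja w0 h0 wh' (ltW delta0) K0 qa p_ge p_le (a_down adown).
    move: gA_a h1; rewrite /f !ler_norml => /andP[? ?] ?.
    by real_lra.
  (* Down, then up: the fall by [2 * lam] is excluded like the climb above, with [- x] for [x]. *)
  + have Vb : V b <= - lam by apply: up; rewrite ?mmb1//; nat_lia.
    have := slope_bound Ja w0 h0 wh' (ltW delta0) K0 qa ab_ge ab_le (a_down adown).
    move: pA_b' a_pA' gB_b gA_a gAB.
    rewrite /f !ler_norml => ? ? /andP[? ?] /andP[? ?] /andP[? ?].
    by real_lra.
Qed.

(** * Transfer to the change points of the estimate *)

Lemma dist_nat_le (R : realType) (s t w : nat) :
  `|s%:R - t%:R : R| <= w%:R -> (t - w <= s <= t + w)%N.
Proof.
rewrite ler_norml => /andP[h1 h2].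
have : (t%:R : R) <= (s + w)%:R by rewrite natrD; lra.
have : (s%:R : R) <= (t + w)%:R by rewrite natrD; lra.
by rewrite !ler_nat; nat_lia.
Qed.

Section change_points.
Variables (R : realType) (N : nat) (m : 'cV[R]_N) (M : nat) (t : nat -> nat).
Hypothesis cps : change_point_sequence m M t.

Lemma change_point_sequence_le (i j : nat) : (i <= j <= M)%N -> (t i <= t j)%N.
Proof.
case: cps => _ _ tS _; elim: j => [|j IH]; first by case: i.
case/andP; rewrite leq_eqVlt => /orP[/eqP -> //|ij jM].
apply: leq_trans (IH _) (ltnW (tS j jM)).
by rewrite -ltnS ij ltnW.
Qed.

Lemma change_point_sequence_const (k s : nat) : (1 <= k <= M)%N ->
  (t k.-1 <= s < t k)%N -> entry m s = entry m (t k.-1).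
Proof.
case: cps => t0 tM tS cp kM; elim: s => [|s IH] hs.
  by congr (entry m _); nat_lia.
have [->//|ts] := eqVneq (t k.-1) s.+1.
rewrite -IH; last by nat_lia.
have [//|/eqP ne] := eqVneq (entry m s.+1) (entry m s).
have t1 : (1 <= t k.-1)%N by rewrite -t0; apply: change_point_sequence_le; nat_lia.
have tkM : (t k <= t M)%N by apply: change_point_sequence_le; nat_lia.
have : change_point m s.+1 by split=> //; nat_lia.
move/cp => [j jM sj].
have [jk|kj] := leqP j k.-1.
  by have := @change_point_sequence_le j k.-1; nat_lia.
by have := @change_point_sequence_le k j; nat_lia.
Qed.

End change_points.

(** Here [g] is the partial sum of the centred noise. The noise mean [mu] is absorbed into the
    levels of the signal, whose jumps it leaves unchanged. *)
Lemma no_change_points_match (R : realType) (N : nat) (m0 y m : 'cV[R]_N)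
    (g : nat -> R) (mu lambda e delta D K : R) (M : nat) (t : nat -> nat)
    (k h w tau1 tau2 : nat) :
  change_point_sequence m0 M t ->
  (1 <= k)%N -> (k.+1 <= M.-1)%N ->
  jump_sign m0 t k = jump_sign m0 t k.+1 ->
  (forall s, (1 <= s <= N)%N ->
     g s.+1 - g s = entry y s - (entry m0 s + mu)) ->
  0 < lambda -> is_flsa_estimate y lambda m ->
  e * N%:R <= w%:R ->
  (3 * w < h)%N -> (10 * w < t k.+1 - t k)%N ->
  (forall j, (1 <= j <= M)%N -> (t j.-1 + 2 * h <= t j)%N) ->
  (t k + 3 * w <= tau1 <= t k.+1 - w)%N ->
  (t k + 3 * w <= tau2 <= t k.+1 - w)%N ->
  0 <= K ->
  (t k.+1)%:R - (t k)%:R + 2 * w%:R <= K * (h%:R - w%:R) ->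
  0 < delta -> (2 * K + 8) * delta <= D ->
  (forall s, (t k - w <= s <= t k + w)%N -> `|g s - g (t k)| <= delta) ->
  (forall s, (t k.+1 - w <= s <= t k.+1 + w)%N ->
     `|g s - g (t k.+1)| <= delta) ->
  `|g (t k.+1) - g (t k)| <= delta ->
  `|g (t k - h)%N - g (t k)| <= delta ->
  `|g (t k.+1 + h)%N - g (t k.+1)| <= delta ->
  D <= g tau1 - g (t k) -> D <= g (t k) - g tau2 ->
  ~ change_points_match e m0 m.
Proof.
move=> cps k1 kM sgE g_rec lam0 opt eN wh AB gap tau1_mid tau2_mid K0 AB_K.
move=> delta0 D_ge gA gB gAB gAh gBh g1 g2 [near1 near2].
have [t0 tM tS cp] := cps.
have A1 : (1 <= t k.-1)%N by rewrite -t0; apply: (change_point_sequence_le cps); nat_lia.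
have A2 : (t k.-1 + 2 * h <= t k)%N by apply: gap; nat_lia.
have B2 : (t k.+1 + 2 * h <= t k.+2)%N by apply: (gap k.+2); nat_lia.
have BN : (t k.+2 <= N.+1)%N.
  by rewrite -tM; apply: (change_point_sequence_le cps); nat_lia.
have rangeN s : (t k - h <= s <= t k.+1 + h)%N -> (2 <= s <= N)%N by nat_lia.
have cpE s : (2 <= s <= N)%N -> entry m s != entry m s.-1 -> change_point m s.
  by move=> sN /eqP ne.
have close s s' : `|s%:R - s'%:R : R| <= e * N%:R -> (s' - w <= s <= s' + w)%N.
  by move=> h1; apply: (@dist_nat_le R); exact: le_trans eN.
(* All other change points of [m0] are at least [2 * h] away from these two, so their windows do not
   reach this range. *)
have loc s : (t k - h < s <= t k.+1 + h)%N -> entry m s != entry m s.-1 ->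
    (t k - w <= s <= t k + w)%N \/ (t k.+1 - w <= s <= t k.+1 + w)%N.
  move=> hs ne; have sN : (2 <= s <= N)%N by apply: rangeN; nat_lia.
  have [s' /cp[j jM ->] /close tjs] := near1 s (cpE s sN ne).
  have [jk|jk] := leqP j k.-1.
    have tjk : (t j <= t k.-1)%N by apply: (change_point_sequence_le cps); nat_lia.
    by exfalso; nat_lia.
  have [kj|kj] := leqP k.+2 j.
    have tjk : (t k.+2 <= t j)%N by apply: (change_point_sequence_le cps); nat_lia.
    by exfalso; nat_lia.
  have [jk'|jk'] := eqVneq j k; first by left; rewrite -jk'.
  by right; rewrite (_ : k.+1 = j)//; nat_lia.
have ex j : (1 <= j < M)%N -> exists s,
    (t j - w <= s <= t j + w)%N && (entry m s != entry m s.-1).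
  move=> jM; have [s [sN /eqP ne] /close sj] : exists2 s, change_point m s &
      `|s%:R - (t j)%:R : R| <= e * N%:R.
    by apply: near2; apply/cp; exists j.
  by exists s; rewrite sj ne.
have exA : exists s, (t k - w <= s <= t k + w)%N && (entry m s != entry m s.-1).
  by apply: ex; nat_lia.
have exB : exists s,
    (t k.+1 - w <= s <= t k.+1 + w)%N && (entry m s != entry m s.-1).
  by apply: ex; nat_lia.
pose al := entry m0 (t k.-1); pose be := entry m0 (t k).
pose ga := entry m0 (t k.+1).
have ss_al s : (t k - h <= s < t k)%N -> entry m0 s = al.
  by move=> hs; apply: (change_point_sequence_const cps (k := k)); nat_lia.
have ss_be s : (t k <= s < t k.+1)%N -> entry m0 s = be.
  by move=> hs; apply: (change_point_sequence_const cps (k := k.+1)); rewrite /=; nat_lia.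
have ss_ga s : (t k.+1 <= s < t k.+1 + h)%N -> entry m0 s = ga.
  by move=> hs; apply: (change_point_sequence_const cps (k := k.+2)); rewrite /=; nat_lia.
have Epred : entry m0 (t k).-1 = al by apply: ss_al; nat_lia.
have beal : be - al != 0.
  have /cp[_ /eqP ne] : exists2 j, (1 <= j < M)%N & t k = t j by exists k => //; nat_lia.
  by rewrite subr_eq0 -Epred.
have rec s : (t k - h <= s < t k.+1 + h)%N ->
    residual_walk y m s.+1 - residual_walk y m s =
    entry m0 s + mu - entry m s + (g s.+1 - g s).
  move=> hs; rewrite residual_walkS; last by nat_lia.
  by rewrite g_rec; [ring|nat_lia].
move: sgE; rewrite /jump_sign /= -/al -/be -/ga => sgE.
have [pos|neg|zero] := ltrgtP 0 (be - al); last by rewrite -zero eqxx in beal.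
- have gabe : 0 < ga - be by rewrite -sgr_cp0 -sgE sgr_cp0.
  apply: (@no_taut_string_match R (residual_walk y m) g
    (fun s => entry m0 s + mu) (entry m) (t k) (t k.+1) h w tau1 tau2 lambda
    (al + mu) (be + mu) (ga + mu) delta D K) => //.
  + by nat_lia.
  + by move=> s /rangeN; exact: residual_walk_le.
  + by move=> s hs; apply: residual_walk_up => //; apply: rangeN; nat_lia.
  + by move=> s hs; apply: residual_walk_down => //; apply: rangeN; nat_lia.
  + by move=> s /ss_al ->.
  + by move=> s /ss_be ->.
  + by move=> s /ss_ga ->.
  + by lra.
  + by lra.
  + by nat_lia.
- have gabe : ga - be < 0 by rewrite -sgr_cp0 -sgE sgr_cp0.
  have normB (p q : R) : `|p - q| <= delta -> `|- p - - q| <= delta.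
    by rewrite -opprD normrN.
  (* Negation turns downward jumps into upward ones and exchanges peak and dip, hence [tau2] before
     [tau1]. *)
  apply: (@no_taut_string_match R (fun s => - residual_walk y m s)
    (fun s => - g s) (fun s => - (entry m0 s + mu)) (fun s => - entry m s)
    (t k) (t k.+1) h w tau2 tau1 lambda
    (- (al + mu)) (- (be + mu)) (- (ga + mu)) delta D K) => //.
  + by nat_lia.
  + by move=> s /rec; lra.
  + by move=> s /rangeN sN; rewrite normrN; exact: residual_walk_le.
  + move=> s hs; rewrite ltrN2 => ms; rewrite lerN2.
    by apply: residual_walk_down => //; apply: rangeN; nat_lia.
  + move=> s hs; rewrite ltrN2 => ms; rewrite lerNr.
    by apply: residual_walk_up => //; apply: rangeN; nat_lia.
  + by move=> s hs; rewrite eqr_opp; exact: loc.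
  + by have [s] := exA; exists s; rewrite eqr_opp.
  + by have [s] := exB; exists s; rewrite eqr_opp.
  + by move=> s /ss_al ->.
  + by move=> s /ss_be ->.
  + by move=> s /ss_ga ->.
  + by lra.
  + by lra.
  + by nat_lia.
  + by move=> s /gA; exact: normB.
  + by move=> s /gB; exact: normB.
  + exact: normB.
  + exact: normB.
  + exact: normB.
  + by lra.
  + by lra.
Qed.

(** * Inconsistency *)

Lemma probability_setI_neq0 (R : realType) (d : measure_display)
    (T : measurableType d) (P : probability T R) (A E : set T) (x y : R) :
  measurable A -> measurable E -> (x%:E <= P A)%E -> (y%:E <= P E)%E ->
  1 < x + y -> exists w, A w /\ E w.
Proof.
move=> mA mE xA yE xy1; apply: contrapT => AE0.
have AE : A `&` E = set0.
  by apply/seteqP; split => // w [Aw Ew]; apply: AE0; exists w.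
have : (P (A `|` E) <= 1)%E by apply: probability_le1; exact: measurableU.
rewrite measureU// => PAE.
have := le_trans (leeD xA yE) PAE.
by rewrite -EFinD lee_fin leNgt xy1.
Qed.

Lemma expRN_le (R : realType) (y z : R) : 0 < y -> 2 / y <= z ->
  2 * expR (- z) <= y.
Proof.
move=> y0 yz.
have z0 : 0 < 2 / y by rewrite divr_gt0.
have : (expR z)^-1 <= (2 / y)^-1.
  rewrite lef_pV2 ?posrE ?expR_gt0// (le_trans yz)//.
  by have := expR_ge1Dx z; lra.
rewrite expRN invf_div; lra.
Qed.

(** Rounding [c * x / 4] down and [ep * x] up; since [ep * x >= 1] and [c * x >= 200], each rounding
    costs at most a factor 2. *)
Lemma window_scales (R : realType) (c ep x : R) : 0 < ep -> ep <= c / 200 ->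
  1 <= ep * x -> 0 <= x -> exists h w : nat,
    (c * x / 8 <= h%:R <= c * x / 4) /\ (ep * x <= w%:R <= 2 * ep * x).
Proof.
move=> ep0 epc epx x0.
have cx : 200 <= c * x by have := ler_wpM2r x0 epc; lra.
have c4 : 0 <= c * x / 4 by lra.
have e4 : 0 <= ep * x by lra.
have /andP[h1 h2] := truncn_itv c4.
have /andP[w1 w2] := truncn_itv e4.
move: h2; rewrite -(natr1 (Num.truncn _)) => h2.
move: w2; rewrite -(natr1 (Num.truncn _)) => w2.
exists (Num.truncn (c * x / 4)), (Num.truncn (ep * x)).+1.
rewrite -(natr1 (Num.truncn (ep * x))).
by split; apply/andP; split; lra.
Qed.

Lemma walk1 (R : realType) (d : measure_display) (T : measurableType d)
    (P : probability T R) (N : nat) (X : 'I_N -> {RV P >-> R}) (m : R)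
    (i : 'I_N) (w : T) : walk X m i i.+1 w = X i w - m.
Proof.
rewrite /walk subSnn mul1r /block_sum; congr (_ - _).
rewrite (_ : ord_itv N i i.+1 = [set i]%SET) ?big_set1//.
by apply/setP => j; rewrite !inE ltnS -eqn_leq eq_sym.
Qed.

Theorem theorem2p1 (R : realType) (d : measure_display) (T : measurableType d)
    (P : probability T R)
    (m0 : forall N : nat, 'cV[R]_N)
    (eps : forall N : nat, 'I_N -> {RV P >-> R})
    (mu sigma : nat -> R)
    (y : forall N : nat, T -> 'cV[R]_N)
    (M0 : nat -> nat) (t0 : nat -> nat -> nat)
    (c : R) (N1 : nat) :
  (forall N, 0 < sigma N) ->
  (forall N, iid_normal (@eps N) (mu N) (sigma N)) ->
  (forall N w, y N w = m0 N + \col_(i < N) eps N i w) ->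
  (forall N, (N1 <= N)%N -> change_point_sequence (m0 N) (M0 N) (t0 N)) ->
  0 < c ->
  (forall N, (N1 <= N)%N -> forall k, (1 <= k <= M0 N)%N ->
     c * N%:R <= (t0 N k)%:R - (t0 N k.-1)%:R) ->
  (forall N, (N1 <= N)%N -> exists2 k, (1 <= k /\ k.+1 <= (M0 N).-1)%N &
     jump_sign (m0 N) (t0 N) k = jump_sign (m0 N) (t0 N) k.+1) ->
  eps_sign_inconsistent P m0 y.
Proof.
move=> sigma0 iid yE cps c0 gapR signs consistent.
(* As [h - w >= c * N / 10], this [K] makes [K * (h - w)] at least [2 * N]. The oscillation height
   [kap * Q] exceeds the required [(2 * K + 8) * Q] by a margin [Q]. The value [rho] depends neither
   on [N] nor on the variance, since [Q] cancels. *)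
pose K := 20 / c; pose kap := 2 * K + 9.
pose rho : R := 8^-1 * ((Num.sqrt (pi *+ 2))^-1 * expR (- (45 * kap ^+ 2 / c))).
have K0 : 0 < K by rewrite divr_gt0.
have pi2 : 0 < Num.sqrt ((pi : R) *+ 2) by rewrite sqrtr_gt0 mulrn_wgt0// pi_gt0.
have rho0 : 0 < rho by rewrite mulr_gt0// mulr_gt0 ?invr_gt0 ?expR_gt0.
have r50 : 0 < rho ^+ 5 by rewrite exprn_gt0.
(* The first bound makes the windows short relative to [h], the second makes leaving the window
   bounds unlikely relative to [rho ^+ 5]. *)
pose ep := Num.min (c / 200) (rho ^+ 5 / (256 * 256)).
have n256 : 0 < 256 :> R by rewrite ltr0n.
have ep0 : 0 < ep.
  rewrite /ep lt_min; apply/andP; split; apply: divr_gt0.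
  - exact: c0.
  - by rewrite ltr0n.
  - exact: r50.
  - exact: (mulr_gt0 n256 n256).
have epc : ep <= c / 200 by rewrite ge_min lexx.
have epr : ep <= rho ^+ 5 / (256 * 256) by rewrite ge_min lexx orbT.
have gam0 : 0 < rho ^+ 5 / 4 by rewrite divr_gt0.
(* The oscillation has probability at least [rho ^+ 5 / 2], so it must meet any event of probability
   [1 - rho ^+ 5 / 4]. *)
have [N0 consN] := consistent ep (rho ^+ 5 / 4) ep0 gam0.
pose N := maxn (maxn N0 N1) (Num.truncn ep^-1).+1.
have NN0 : (N0 <= N)%N by rewrite /N !leq_max leqnn.
have NN1 : (N1 <= N)%N by rewrite /N !leq_max leqnn orbT.
have epN : 1 <= ep * N%:R.
  rewrite mulrC -ler_pdivrMr// div1r.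
  apply: le_trans (ltW (truncnS_gt _)) _.
  by rewrite ler_nat /N leq_max leqnn orbT.
have [A [mA PA AP]] := consN N NN0.
have [k [k1 kM] sgE] := signs N NN1.
move: (cps N NN1) (gapR N NN1) (sigma0 N) (iid N) (yE N) A mA PA AP sgE kM.
move: (m0 N) (M0 N) (t0 N) (sigma N) (mu N) (eps N) (y N).
clearbody N; clear - n256 K0 pi2 rho0 r50 ep0 epc epr epN c0 k1.
move=> {}m0 {}M0 {}t0 s m X {}y {}cps gap s0 iidX {}yE A mA PA AP sgE kM.
have x0 : 0 <= N%:R :> R by [].
have [h [w [/andP[h1 h2] /andP[w1 w2]]]] := window_scales ep0 epc epN x0.
have t0P := cps; case: t0P => t00 t0M _ _.
have A1 : (1 <= t0 k.-1)%N.
  by rewrite -t00; apply: (change_point_sequence_le cps); nat_lia.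
have BN : (t0 k.+2 <= N.+1)%N.
  by rewrite -t0M; apply: (change_point_sequence_le cps); nat_lia.
have gap4 j : (1 <= j <= M0)%N -> (t0 j.-1 + 4 * h <= t0 j)%N.
  move=> jM; rewrite -(ler_nat R) natrD natrM.
  by have := gap j jM; lra.
have wh : (10 * w <= h)%N.
  rewrite -(ler_nat R) natrM.
  by have := ler_wpM2r x0 epc; lra.
have w_gt0 : (0 < w)%N by rewrite -(ltr_nat R); lra.
have gA := gap4 k ltac:(nat_lia).
have gB := gap4 k.+1 ltac:(nat_lia).
have gC := gap4 k.+2 ltac:(nat_lia).
rewrite /= in gB gC.
have N0 : 0 < N%:R :> R by rewrite ltr0n; nat_lia.
pose Q := s * Num.sqrt N%:R.
have sqN : 0 < Num.sqrt (N%:R : R) by rewrite sqrtr_gt0.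
have Q0 : 0 < Q by rewrite mulr_gt0.
have Q2 : Q ^+ 2 = s ^+ 2 * N%:R by rewrite exprMn sqr_sqrtr.
pose q := s * Num.sqrt (c * N%:R / 10).
have cN : 0 < c * N%:R / 10 by rewrite divr_gt0// mulr_gt0.
have q0 : 0 < q by rewrite mulr_gt0// sqrtr_gt0.
have q2 : q ^+ 2 = s ^+ 2 * (c * N%:R / 10).
  by rewrite exprMn sqr_sqrtr// ltW.
(* At most five errors of size [u] accumulate in the estimates below, which stays within [Q]. *)
pose e := kap * Q; pose u := Q / 8.
have kap9 : 9 <= kap by rewrite /kap; lra.
have u0 : 0 < u by rewrite divr_gt0.
have Qe := ler_wpM2r (ltW Q0) kap9; rewrite -/e in Qe.
have ue : u <= e by rewrite /u; lra.
have hw : c * N%:R / 10 <= (h - w)%:R.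
  rewrite natrB; last by nat_lia.
  by have := ler_wpM2r x0 epc; lra.
have len l : (h - w <= l <= N)%N -> q <= s * Num.sqrt l%:R <= Q.
  move=> /andP[hl lN]; rewrite /q /Q !ler_pM2l//.
  apply/andP; split; apply: ler_wsqrtr; last by rewrite ler_nat.
  by rewrite (le_trans hw)// ler_nat.
pose pA := t0 k; pose pB := t0 k.+1.
have rhoE : u * (normal_peak Q * expR (- ((3 * e) ^+ 2 / (2 * q ^+ 2)))) = rho.
  rewrite normal_peakE// /rho (_ : _ / _ = 45 * kap ^+ 2 / c).
    by rewrite /u; field; rewrite !gt_eqF.
  rewrite q2 (_ : (3 * e) ^+ 2 = 9 * kap ^+ 2 * (s ^+ 2 * N%:R)).
    by field; rewrite !gt_eqF.
  by rewrite -Q2 /e; ring.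
have tail : 2 * expR (- (3 * (u / 2) ^+ 2 / (8 * ((2 * w)%:R * s ^+ 2)))) <=
    rho ^+ 5 / 8.
  apply: expRN_le; first by rewrite divr_gt0.
  have w0 : 0 < w%:R :> R by rewrite ltr0n.
  (* Only the ratio of [N] to [w] remains, and [w <= 2 * ep * N] makes it large enough. *)
  have -> : 3 * (u / 2) ^+ 2 / (8 * ((2 * w)%:R * s ^+ 2)) =
      3 * N%:R / (16 * 256 * w%:R).
    rewrite natrM (_ : (u / 2) ^+ 2 = s ^+ 2 * N%:R / 256).
      by field; rewrite !gt_eqF.
    by rewrite -Q2 /u; field.
  rewrite ler_pdivlMr; last first.
    by apply: mulr_gt0 w0; apply: mulr_gt0 n256; rewrite ltr0n.
  rewrite [leLHS](_ : _ = 256 * 256 * w%:R / rho ^+ 5).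
    rewrite ler_pdivrMr//.
    by have := ler_wpM2r x0 epr; lra.
  by field; rewrite gt_eqF.
(* The predecessors translate times counted from 1 into indices counted from 0. The peak is placed
   at [pA + h] and the dip at [pA + 2 * h]. *)
have := @oscillation_event _ _ _ _ _ _ _ _ s0 iidX (pA - h).-1 (pA - w).-1
  (pA + w).-1 (pA + h).-1 (pA + 2 * h).-1 (pB - w).-1 (pB + w).-1 (pB + h).-1
  (2 * w)%N q Q e u.
rewrite rhoE /=.
have len5 l : l \in [:: (pA - w).-1 - (pA - h).-1; (pA + h).-1 - (pA + w).-1;
      (pA + 2 * h).-1 - (pA + h).-1; (pB - w).-1 - (pA + 2 * h).-1;
      (pB + h).-1 - (pB + w).-1]%N -> q <= s * Num.sqrt l%:R <= Q.
  move=> lin; apply: len; move: lin; rewrite /pA /pB !inE.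
  by do 4?[case/orP]; move/eqP; nat_lia.
case=> //; rewrite /pA /pB; try by nat_lia.
move=> E [mE PE EP].
have [v [Av Ev]] : exists v, A v /\ E v.
  by apply: probability_setI_neq0 mA mE PA PE _; lra.
have [lambda [est [lam0 opt match_]]] := AP v Av.
have [[X0 X4] W1 W2 [/andP[X1 X1'] /andP[X2 X2'] /andP[X3 X3']]] := EP v Ev.
pose g t := walk X m 0 t.-1 v.
have gD a b : (a <= b)%N -> g b - g a = walk X m a.-1 b.-1 v.
  move=> ab; rewrite /g (@walkD _ _ _ _ _ _ _ 0 a.-1); last by nat_lia.
  by rewrite addrC addKr.
have win1 i : (t0 k - w <= i <= t0 k + w)%N -> `|g i - g (t0 k - w)%N| <= u.
  move=> hi; rewrite gD; last by nat_lia.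
  have := W1 (i - (t0 k - w))%N ltac:(nat_lia).
  by rewrite (_ : ((t0 k - w).-1 + _)%N = i.-1); last by nat_lia.
have win2 i : (t0 k.+1 - w <= i <= t0 k.+1 + w)%N ->
    `|g i - g (t0 k.+1 - w)%N| <= u.
  move=> hi; rewrite gD; last by nat_lia.
  have := W2 (i - (t0 k.+1 - w))%N ltac:(nat_lia).
  by rewrite (_ : ((t0 k.+1 - w).-1 + _)%N = i.-1); last by nat_lia.
rewrite -!gD in X0 X1 X1' X2 X2' X3 X3' X4; try by nat_lia.
have a0 := win1 (t0 k) ltac:(nat_lia).
have a1 := win1 (t0 k + w)%N ltac:(nat_lia).
have b0 := win2 (t0 k.+1) ltac:(nat_lia).
have b1 := win2 (t0 k.+1 + w)%N ltac:(nat_lia).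
have eE : e = (2 * K + 8) * Q + Q by rewrite /e /kap; ring.
have uE : 8 * u = Q by rewrite /u; field.
have KQ0 : 0 <= K * Q by rewrite mulr_ge0// ltW.
have AB_K : (t0 k.+1)%:R - (t0 k)%:R + 2 * w%:R <= K * (h%:R - w%:R).
  have BN' : ((t0 k.+1 + 2 * w)%:R : R) <= (t0 k + N)%:R.
    by rewrite ler_nat; nat_lia.
  rewrite (natrD _ (t0 k.+1)) (natrD _ (t0 k)) natrM in BN'.
  rewrite -(@natrB _ h w); last by nat_lia.
  have := ler_wpM2l (ltW K0) hw.
  have -> : K * (c * N%:R / 10) = 2 * N%:R by rewrite /K; field; rewrite gt_eqF.
  by real_lra.
clear - cps k1 kM sgE lam0 opt match_ yE Q0 w1 gap4 wh w_gt0 A1 BN gA gB gC K0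
  AB_K gD win1 win2 X0 X1 X1' X2 X2' X3 X3' X4 a0 a1 b0 b1 eE uE KQ0.
clearbody e u Q K ep g.
apply: (no_change_points_match (y := y v) (g := g) (mu := m) (e := ep)
  (delta := Q) (D := (2 * K + 8) * Q) (K := K) (h := h) (w := w)
  (tau1 := (t0 k + h)%N) (tau2 := (t0 k + 2 * h)%N) cps k1 kM sgE _ lam0 opt)
  => //; try by nat_lia.
- move=> i iN; rewrite gD//.
  case: i iN => // i /= iN.
  rewrite -[i]/(nat_of_ord (Ordinal iN)) walk1 !entryE yE !mxE.
  by ring.
- by move=> j /gap4; nat_lia.
- exact: ltW.
- move=> i hi; have := win1 i hi; move: a0.
  rewrite !ler_norml => /andP[? ?] /andP[? ?].
  by apply/andP; split; real_lra.
- move=> i hi; have := win2 i hi; move: b0.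
  rewrite !ler_norml => /andP[? ?] /andP[? ?].
  by apply/andP; split; real_lra.
- move: a0 a1 b0; rewrite !ler_norml => /andP[? ?] /andP[? ?] /andP[? ?].
  by apply/andP; split; real_lra.
- move: a0 X0; rewrite !ler_norml => /andP[? ?] /andP[? ?].
  by apply/andP; split; real_lra.
- move: b0 b1 X4; rewrite !ler_norml => /andP[? ?] /andP[? ?] /andP[? ?].
  by apply/andP; split; real_lra.
- move: a0 a1; rewrite !ler_norml => /andP[? ?] /andP[? ?].
  by real_lra.
- move: a0 a1; rewrite !ler_norml => /andP[? ?] /andP[? ?].
  by real_lra.
Qed.
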